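(* Let $A$ be the Banach algebra $\ell^1(\mathbb N)$ with pointwise multiplication, with standard unit basis $(\delta_j)_{j\ge1}$. Let $\mathcal F$ be the family of finite non-empty subsets of $\mathbb N$, and let $\mathcal M=\prod_{F\in\mathcal F}\mathbb M_{F\cup\{\alpha,\omega\}}$, a finite Type I von Neumann algebra with separable predual. Let $\phi:A\to\mathcal M$ be the bounded linear map determined by $\phi(\delta_j)_F=E_j$ if $j\in F$ and $\phi(\delta_j)_F=0$ if $j\notin F$, where $E_j$ is the rank-one idempotent defined in the context. Then $\phi$ is an algebra homomorphism with $$\tfrac1\pi\|a\|_1\le\|\phi(a)\|\le 3\|a\|_1\qquad(a\in\ell^1(\mathbb N)),$$ so that $\phi$ has closed range. Consequently $\phi(A)$ is a closed subalgebra of the finite Type I von Neumann algebra $\mathcal M$ which is commutative, semisimple, singly generated as a Banach algebra, and biflat, but not amenable.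
   Context: Here $\alpha,\omega$ are two formal symbols not in $\mathbb N=\{1,2,\dots\}$. On $\ell^2(\mathbb N\cup\{\alpha,\omega\})$ with standard basis $e_\alpha,e_\omega,e_1,e_2,\dots$, put $x_n=e_\omega+e_\alpha+e_n$, $y_n=e_\omega-e_\alpha+e_n$ and $E_n(\xi)=\langle \xi,x_n\rangle\,y_n$ for $n\in\mathbb N$; $E_n$ and $E_n^*$ have range in $\operatorname{lin}(e_\alpha,e_\omega,e_n)$. For $F\in\mathcal F$, $\mathbb M_{F\cup\{\alpha,\omega\}}$ is the algebra of complex square matrices indexed by $F\cup\{\alpha,\omega\}$ with the usual $C^*$-norm (acting on $\ell^2(F\cup\{\alpha,\omega\})$); for $j\in F$, $E_j$ is identified with an element of $\mathbb M_{F\cup\{\alpha,\omega\}}$. The product $\prod_{F}$ is the $\ell^\infty$-direct product: bounded families $(x_F)_F$ with norm $\sup_F\|x_F\|$. A Banach algebra $A$ is singly generated if there is $b\in A$ such that the smallest norm-closed subalgebra containing $b$ (not required to contain an identity) is $A$. A Banach algebra $A$ is biflat if there is a continuous linear $A$-bimodule map $\sigma:A\to (A\widehat\otimes A)^{**}$ such that $\pi^{**}\sigma=\kappa_A$, where $\widehat\otimes$ is the projective tensor product, $\pi:A\widehat\otimes A\to A$ is the linearized multiplication map, and $\kappa_A:A\to A^{**}$ is the canonical embedding. Amenable means amenable as a Banach algebra in the sense of Johnson (equivalently, possessing a bounded approximate diagonal). *)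

(* Defs.v *)
From HB Require Import structures.
From mathcomp Require Import all_boot all_order all_algebra finmap.
From mathcomp Require Import lra.
From mathcomp Require Import sesquilinear spectral complex.
From mathcomp Require Import all_classical all_reals topology normedtype sequences.
Set Implicit Arguments.
Unset Strict Implicit.
Unset Printing Implicit Defensive.
Import Order.TTheory GRing.Theory Num.Theory.
Import numFieldNormedType.Exports.
Local Open Scope classical_set_scope.
Local Open Scope complex_scope.
Local Open Scope sesquilinear_scope.
Local Open Scope ring_scope.

(* Norms of normed spaces over R[i] take their values in R[i]; rnorm is the
   same norm seen in R. *)
Definition rnorm (R : realType) (V : normedZmodType R[i]) (x : V) : R :=
  complex.Re `|x|.

Section Rnorm.
Variable R : realType.
Implicit Type V : normedZmodType R[i].

Lemma rnormE V (x : V) : `|x| = (rnorm x)%:C.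
Proof. by rewrite /rnorm RRe_real ?normr_real. Qed.

Lemma rnorm_ge0 V (x : V) : 0 <= rnorm x.
Proof. by rewrite -ler0c -rnormE normr_ge0. Qed.

Lemma rnormD V (x y : V) : rnorm (x + y) <= rnorm x + rnorm y.
Proof. by rewrite -lecR rmorphD/= -!rnormE ler_normD. Qed.

Lemma rnormN V (x : V) : rnorm (- x) = rnorm x.
Proof. by rewrite /rnorm normrN. Qed.

Lemma rnormB V (x y : V) : rnorm (x - y) = rnorm (y - x).
Proof. by rewrite /rnorm distrC. Qed.

Lemma rnorm0 V : rnorm (0 : V) = 0.
Proof. by rewrite /rnorm normr0. Qed.

Lemma rnorm0_eq0 V (x : V) : rnorm x = 0 -> x = 0.
Proof. by move=> x0; apply/eqP; rewrite -normr_eq0 rnormE x0. Qed.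

Lemma rnormM (x y : R[i]) : rnorm (x * y) = rnorm x * rnorm y.
Proof. by apply: complexI; rewrite rmorphM/= -!rnormE normrM. Qed.

Lemma rnormZ (V : normedModType R[i]) c (x : V) :
  rnorm (c *: x) = rnorm c * rnorm x.
Proof. by apply: complexI; rewrite rmorphM/= -!rnormE normrZ. Qed.

Lemma ler_rnormB V (x y z : V) : rnorm (x - z) <= rnorm (x - y) + rnorm (y - z).
Proof. by rewrite (le_trans _ (rnormD _ _))// addrA subrK. Qed.

Lemma rnorm_sum V (I : Type) (s : seq I) (P : pred I) (f : I -> V) :
  rnorm (\sum_(i <- s | P i) f i) <= \sum_(i <- s | P i) rnorm (f i).
Proof.
elim/big_ind2 : _ => [|x a y b ha hb|//]; first by rewrite rnorm0.
by rewrite (le_trans (rnormD _ _))// lerD.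
Qed.

End Rnorm.

Section Completeness.
Variables (R : realType) (V : normedModType R[i]).

Lemma cauchy_rnorm (F : set_system V) : ProperFilter F -> cauchy F ->
  forall e : R, 0 < e -> exists a, \forall b \near F, rnorm (a - b) <= e.
Proof.
move=> FF /cauchyP Fc e e0.
have /Fc[a Fa] : 0 < e%:C by rewrite ltcR.
exists a; apply: filterS Fa => b; rewrite -ball_normE/= rnormE ltcR.
exact: ltW.
Qed.

Lemma cvg_rnorm (F : set_system V) (x : V) : Filter F ->
  (forall e : R, 0 < e -> \forall b \near F, rnorm (x - b) <= e) -> F --> x.
Proof.
move=> FF h; apply/cvgrPdist_le => e e0.
have eR : e = (complex.Re e)%:C by rewrite RRe_real// gtr0_real.
have /h : 0 < complex.Re e by move: e0; rewrite ltcE => /andP[].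
by apply: filterS => b xb; rewrite rnormE eR lecR.
Qed.

(* A normed space whose norm is the supremum of the seminorms p k is complete
   as soon as each Cauchy filter has a p k-limit for all k. *)
Lemma cvg_sup_seminorm (K : Type) (p : K -> V -> R) (F : set_system V) (x : V) :
  (forall k x y, p k (x + y) <= p k x + p k y) ->
  (forall k y, p k y <= rnorm y) ->
  (forall y e, 0 <= e -> (forall k, p k y <= e) -> rnorm y <= e) ->
  ProperFilter F -> cauchy F ->
  (forall k (e : R), 0 < e -> \forall b \near F, p k (x - b) <= e) ->
  cvg F.
Proof.
move=> pD ple ub FF Fc h; apply/cvg_ex; exists x.
apply: cvg_rnorm => e e0.
have e3 : 0 < e / 2 by rewrite divr_gt0.
have [a Fa] := cauchy_rnorm FF Fc (divr_gt0 e3 (ltr0n _ 2)).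
have xa : rnorm (x - a) <= e / 2.
  apply: ub => [|k]; first exact: ltW.
  have [b [bk ba]] := filter_ex (filterI (h k _ (divr_gt0 e3 (ltr0n _ 2))) Fa).
  rewrite -(subrK b x) -addrA (le_trans (pD _ _ _))//.
  by rewrite (splitr (e / 2)) lerD// (le_trans (ple _ _))// rnormB.
apply: filterS Fa => b ab.
rewrite (le_trans (ler_rnormB _ a _))// (splitr e) lerD// (le_trans ab)//.
lra.
Qed.

End Completeness.

(* The operator norm of f : V -> W for the norms nV and nW. *)
Definition opn (R : realType) (V W : Type) (nV : V -> R) (nW : W -> R)
  (f : V -> W) : R := sup [set nW (f x) | x in [set x | nV x <= 1]].

Section Opn.
Variables (R : realType) (V W : lmodType R[i]) (nV : V -> R) (nW : W -> R).
Hypothesis nV0 : nV 0 = 0.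
Hypothesis nVge0 : forall x, 0 <= nV x.
Hypothesis nWge0 : forall x, 0 <= nW x.
Hypothesis nVZ : forall c x, nV (c *: x) = rnorm c * nV x.
Hypothesis nWZ : forall c x, nW (c *: x) = rnorm c * nW x.

Lemma opn_le (f : V -> W) (K : R) : 0 <= K -> (forall x, nW (f x) <= K * nV x) ->
  opn nV nW f <= K.
Proof.
move=> K0 fK; apply: ge_sup; first by exists (nW (f 0)), 0 => //=; rewrite nV0.
by move=> _ [x /= x1 <-]; rewrite (le_trans (fK _))// ler_piMr.
Qed.

Lemma opn_ub (f : V -> W) (K : R) (x : V) : (forall x, nW (f x) <= K * nV x) ->
  nV x <= 1 -> nW (f x) <= opn nV nW f.
Proof.
move=> fK x1; apply: ub_le_sup; last by exists x.
exists `|K| => _ [y /= y1 <-]; rewrite (le_trans (fK _))//.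
by rewrite (le_trans (ler_wpM2r _ (ler_norm K)))// ler_piMr.
Qed.

Lemma opn_ge0 (f : V -> W) (K : R) : (forall x, nW (f x) <= K * nV x) ->
  0 <= opn nV nW f.
Proof. by move=> fK; rewrite (le_trans (nWge0 (f 0)))// (opn_ub fK)// nV0. Qed.

Lemma rnorm_real (r : R) : rnorm r%:C = `|r|.
Proof. by apply: complexI; rewrite -rnormE normc_def/= expr0n addr0 sqrtr_sqr. Qed.

Lemma opn_ge (f : {linear V -> W}) (K : R) (x : V) :
  (forall x, nW (f x) <= K * nV x) -> nW (f x) <= opn nV nW f * nV x.
Proof.
move=> fK; have [x0|x0] := eqVneq (nV x) 0.
  by rewrite (le_trans (fK x))// x0 !mulr0.
have xp : 0 < nV x by rewrite lt_def x0 nVge0.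
have := @opn_ub f K ((nV x)^-1%:C *: x) fK.
rewrite nVZ rnorm_real ger0_norm ?invr_ge0// mulVf// => /(_ (lexx _)).
by rewrite linearZ nWZ rnorm_real ger0_norm ?invr_ge0// ler_pdivrMl// mulrC.
Qed.

End Opn.

HB.mixin Record isBanachAlgebra (R : realType) A of CompleteNormedModule R[i] A := {
  bmul : A -> A -> A;
  bmulA : associative bmul;
  bmulDl : left_distributive bmul +%R;
  bmulDr : right_distributive bmul +%R;
  bmulZl : forall (c : R[i]) x y, bmul (c *: x) y = c *: bmul x y;
  bmulZr : forall (c : R[i]) x y, bmul x (c *: y) = c *: bmul x y;
  bnormM : forall x y, `|bmul x y| <= `|x| * `|y|
}.

(* Complex Banach algebras, not assumed to have an identity. *)
#[short(type="banachAlgType")]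
HB.structure Definition BanachAlgebra (R : realType) :=
  {A of CompleteNormedModule R[i] A & isBanachAlgebra R A}.

Notation "x ** y" := (bmul x y) (at level 40, left associativity) : ring_scope.

HB.mixin Record isCstarAlgebra (R : realType) A of BanachAlgebra R A := {
  star : A -> A;
  starK : involutive star;
  starD : {morph star : x y / x + y};
  starZ : forall (c : R[i]) x, star (c *: x) = c^* *: star x;
  starM : forall x y : A, star (x ** y) = star y ** star x;
  cstar_identity : forall x : A, `|star x ** x| = `|x| ^+ 2
}.

#[short(type="cstarAlgType")]
HB.structure Definition CstarAlgebra (R : realType) :=
  {A of BanachAlgebra R A & isCstarAlgebra R A}.

Section Complex_complete.
Variable R : realType.

Lemma Re_rnorm (z : R[i]) : `|complex.Re z| <= rnorm z.
Proof. by rewrite -lecR -rnormE normc_ge_Re. Qed.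

Lemma Im_rnorm (z : R[i]) : `|complex.Im z| <= rnorm z.
Proof.
rewrite -normrN -ReiNIm (le_trans (Re_rnorm _))// rnormM.
suff -> : rnorm ('i%C : R[i]) = 1 by rewrite mulr1.
by apply: complexI; rewrite -rnormE normc_def/= expr0n expr1n add0r sqrtr1.
Qed.

Lemma rnorm_ReIm (z : R[i]) : rnorm z <= `|complex.Re z| + `|complex.Im z|.
Proof.
rewrite [leLHS]/rnorm [in leLHS](complexE z) -/(rnorm _) (le_trans (rnormD _ _))//.
rewrite rnormM !rnorm_real lerD2l ler_piMl//.
by rewrite -lecR -rnormE normc_def/= expr0n expr1n add0r sqrtr1.
Qed.

Lemma cvg_lip_real (V : normedModType R[i]) (f : V -> R) (F : set_system V) :
  (forall x y, `|f x - f y| <= rnorm (x - y)) -> ProperFilter F -> cauchy F ->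
  cvg (f @ F).
Proof.
move=> fl FF Fc; apply: cauchy_cvg; apply/cauchyP => e e0.
have [a Fa] := cauchy_rnorm FF Fc (divr_gt0 e0 (ltr0n _ 2)).
exists (f a); apply: filterS Fa => b ab /=; apply: le_lt_trans (fl _ _) _.
by rewrite (le_lt_trans ab)//; lra.
Qed.

Lemma complex_complete (F : set_system R[i]^o) :
  ProperFilter F -> cauchy F -> cvg F.
Proof.
move=> FF Fc.
have /cvg_ex[a ha] : cvg ((@complex.Re R : R[i]^o -> R) @ F).
  by apply: cvg_lip_real => // x y; rewrite -raddfB Re_rnorm.
have /cvg_ex[b hb] : cvg ((@complex.Im R : R[i]^o -> R) @ F).
  by apply: cvg_lip_real => // x y; rewrite -raddfB Im_rnorm.
apply/cvg_ex; exists (a +i* b); apply: cvg_rnorm => e e0.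
have e2 : 0 < e / 2 by rewrite divr_gt0.
near=> z; rewrite (le_trans (rnorm_ReIm _))// (splitr e) lerD//.
  suff : `|a - complex.Re (z : R[i])| <= e / 2 by case: (z : R[i]).
  by near: z; move/cvgrPdist_le : ha; apply.
suff : `|b - complex.Im (z : R[i])| <= e / 2 by case: (z : R[i]).
by near: z; move/cvgrPdist_le : hb; apply.
Unshelve. all: by end_near. Qed.

Lemma cauchy_lip (V W : normedModType R[i]) (f : V -> W) (F : set_system V) :
  (forall x y, rnorm (f x - f y) <= rnorm (x - y)) -> ProperFilter F ->
  cauchy F -> cauchy (f @ F).
Proof.
move=> fl FF Fc; apply/cauchyP => e e0.
have eR : e = (complex.Re e)%:C by rewrite RRe_real// gtr0_real.
have Re0 : 0 < complex.Re e by move: e0; rewrite ltcE => /andP[].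
have [a Fa] := cauchy_rnorm FF Fc (divr_gt0 Re0 (ltr0n _ 2)).
exists (f a); apply: filterS Fa => b ab /=.
rewrite -ball_normE/= rnormE eR ltcR (le_lt_trans (fl _ _))//.
by rewrite (le_lt_trans ab)//; lra.
Qed.

End Complex_complete.

Section BoundedLinear.
Variables (R : realType) (E F : normedModType R[i]).

Definition blin_pred : {pred E -> F} := fun f =>
  `[< linear f /\ exists K : R, forall x, rnorm (f x) <= K * rnorm x >].

(* Bounded linear maps E -> F, with the operator norm. *)
Record blin := Blin { blin_fun :> E -> F ; _ : blin_fun \in blin_pred }.

HB.instance Definition _ := [isSub for blin_fun].
HB.instance Definition _ := [Choice of blin by <:].

Lemma blin_submod_closed : submod_closed blin_pred.
Proof.
split.
  apply/asboolP; split => [c x y|]; first by rewrite scaler0 addr0.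
  by exists 0 => x; rewrite mul0r rnorm0.
move=> c f g /asboolP[fl [K fK]] /asboolP[gl [L gL]]; apply/asboolP; split.
  move=> d x y; rewrite !fctE fl gl !scalerDr !scalerA mulrC.
  by rewrite addrACA.
exists (rnorm c * K + L) => x.
rewrite !fctE (le_trans (rnormD _ _))// mulrDl lerD// rnormZ -mulrA.
by rewrite ler_wpM2l// rnorm_ge0.
Qed.

HB.instance Definition _ :=
  GRing.isSubmodClosed.Build R[i] (E -> F) blin_pred blin_submod_closed.
HB.instance Definition _ := [SubChoice_isSubLmodule of blin by <:].

Lemma blin_is_linear (f : blin) : linear f.
Proof. by case: f => f fP; have /asboolP[] := fP. Qed.

HB.instance Definition _ (f : blin) :=
  GRing.isLinear.Build R[i] E F *:%R f (@blin_is_linear f).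

Lemma blin_bounded (f : blin) :
  exists K : R, forall x, rnorm (f x) <= K * rnorm x.
Proof. by case: f => f fP; have /asboolP[] := fP. Qed.

Definition blin_norm (f : blin) : R[i] :=
  (opn (@rnorm R E) (@rnorm R F) f)%:C.

Lemma blin_opn_ge (f : blin) x :
  rnorm (f x) <= opn (@rnorm R E) (@rnorm R F) f * rnorm x.
Proof.
have [K fK] := blin_bounded f.
by apply: (opn_ge _ _ _ _ fK) => *;
  rewrite ?rnorm0 ?rnorm_ge0 ?rnormZ.
Qed.

Lemma blin_opn_le (f : blin) K : 0 <= K ->
  (forall x, rnorm (f x) <= K * rnorm x) -> opn (@rnorm R E) (@rnorm R F) f <= K.
Proof. by move=> K0 fK; apply: opn_le => // *; rewrite ?rnorm0 ?rnorm_ge0. Qed.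

Lemma blin_opn_ge0 (f : blin) : 0 <= opn (@rnorm R E) (@rnorm R F) f.
Proof.
have [K fK] := blin_bounded f.
by apply: (opn_ge0 _ _ _ fK) => *; rewrite ?rnorm0 ?rnorm_ge0.
Qed.

Lemma blin_normD f g : blin_norm (f + g) <= blin_norm f + blin_norm g.
Proof.
rewrite -rmorphD/= lecR; apply: blin_opn_le => [|x].
  by rewrite addr_ge0// blin_opn_ge0.
by rewrite mulrDl (le_trans (rnormD _ _))// lerD// blin_opn_ge.
Qed.

Lemma blin_normZ c f : blin_norm (c *: f) = `|c| * blin_norm f.
Proof.
have le d g : opn (@rnorm R E) (@rnorm R F) (d *: g : blin) <=
    rnorm d * opn (@rnorm R E) (@rnorm R F) (g : blin).
  apply: blin_opn_le => [|x]; first by rewrite mulr_ge0 ?rnorm_ge0 ?blin_opn_ge0.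
  by rewrite rnormZ -mulrA ler_wpM2l ?rnorm_ge0// blin_opn_ge.
rewrite /blin_norm rnormE -rmorphM; congr (_%:C); apply/eqP.
rewrite eq_le le andTb; have [->|c0] := eqVneq c 0.
  by rewrite rnorm0 mul0r blin_opn_ge0.
have c0' : 0 < rnorm c.
  by rewrite lt_def rnorm_ge0 andbT; apply: contra c0 => /eqP/rnorm0_eq0->.
rewrite -ler_pdivlMl// (_ : (rnorm c)^-1 = rnorm c^-1).
  by rewrite -[in leLHS](scale1r f) -(mulVf c0) -scalerA le.
by apply/eqP; rewrite -(inj_eq (mulfI (lt0r_neq0 c0'))) mulfV ?lt0r_neq0//
  -rnormM mulfV// [rnorm 1]rnorm_real normr1.
Qed.

Lemma blin_norm0_eq0 f : blin_norm f = 0 -> f = 0.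
Proof.
move=> /complexI f0; apply/val_inj/funext => x; apply: rnorm0_eq0.
by apply/eqP; rewrite eq_le rnorm_ge0 andbT (le_trans (blin_opn_ge f x))// f0 mul0r.
Qed.

HB.instance Definition _ :=
  Lmodule_isNormed.Build R[i] blin blin_normD blin_normZ blin_norm0_eq0.

Lemma blin_rnormE f : rnorm (f : blin) = opn (@rnorm R E) (@rnorm R F) f.
Proof. by []. Qed.

Lemma blin_rnorm_ge (f : blin) x : rnorm (f x) <= rnorm f * rnorm x.
Proof. exact: blin_opn_ge. Qed.

End BoundedLinear.

Notation dual E := (blin E (_[i]^o)).

Section L1.
Variable R : realType.

Definition l1_pred : {pred nat -> R[i]} := fun a =>
  `[< cvgn (series (fun n => rnorm (a n))) >].

(* The points of N are numbered from 0. *)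
Record l1 := L1 { l1_seq :> nat -> R[i] ; _ : l1_seq \in l1_pred }.

HB.instance Definition _ := [isSub for l1_seq].
HB.instance Definition _ := [Choice of l1 by <:].

Implicit Types a b : nat -> R[i].

Local Notation psum a := (series (fun n => rnorm (a n))).

Lemma psum_nd a : nondecreasing_seq (psum a).
Proof. by apply: nondecreasing_series => *; exact: rnorm_ge0. Qed.

Lemma psum_le a n : a \in l1_pred -> psum a n <= limn (psum a).
Proof. by move=> /asboolP ca; apply: nondecreasing_cvgn_le => //; exact: psum_nd. Qed.

Lemma l1_predP a (K : R) : (forall n, psum a n <= K) -> a \in l1_pred.
Proof.
move=> aK; apply/asboolP/nondecreasing_is_cvgn; first exact: psum_nd.
by exists K => _ [n _ <-].
Qed.

Lemma psum_lim_le a (K : R) : (forall n, psum a n <= K) -> limn (psum a) <= K.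
Proof.
move=> aK; apply: limr_le; first by have /asboolP := l1_predP aK.
exact: nearW.
Qed.

Lemma psumD a b n : psum (a + b) n <= psum a n + psum b n.
Proof. by rewrite /series/= -big_split ler_sum// => i _; exact: rnormD. Qed.

Lemma psumZ c a n : psum (c *: a) n = rnorm c * psum a n.
Proof.
by rewrite /series/= mulr_sumr; apply: eq_bigr => i _; rewrite -rnormM.
Qed.

Lemma l1_submod_closed : submod_closed l1_pred.
Proof.
split.
  apply: (@l1_predP _ 0) => n.
  by rewrite /series/= big1// => i _; rewrite [rnorm _]rnorm0.
move=> c a b aP bP.
apply: (@l1_predP _ (rnorm c * limn (psum a) + limn (psum b))) => n.
rewrite (le_trans (psumD _ _ _))// psumZ lerD ?psum_le//.
by rewrite ler_wpM2l ?rnorm_ge0// psum_le.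
Qed.

HB.instance Definition _ :=
  GRing.isSubmodClosed.Build R[i] (nat -> R[i]) l1_pred l1_submod_closed.
HB.instance Definition _ := [SubChoice_isSubLmodule of l1 by <:].

Definition l1_rnorm (a : l1) : R := limn (psum a).
Definition l1_norm (a : l1) : R[i] := (l1_rnorm a)%:C.

Lemma l1P (a : l1) : (a : nat -> R[i]) \in l1_pred.
Proof. by case: a. Qed.

Lemma l1_psum_le (a : l1) n : psum a n <= l1_rnorm a.
Proof. exact/psum_le/l1P. Qed.

Lemma l1_rnorm_ge0 (a : l1) : 0 <= l1_rnorm a.
Proof. by rewrite (le_trans _ (l1_psum_le a 0))// /series/= big_geq. Qed.

Lemma l1_normD (a b : l1) : l1_norm (a + b) <= l1_norm a + l1_norm b.
Proof.
rewrite -rmorphD/= lecR; apply: psum_lim_le => n.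
by rewrite (le_trans (psumD _ _ _))// lerD// l1_psum_le.
Qed.

Lemma l1_normZ c (a : l1) : l1_norm (c *: a) = `|c| * l1_norm a.
Proof.
rewrite /l1_norm rnormE -rmorphM; congr (_%:C); rewrite /l1_rnorm.
transitivity (limn (fun n => rnorm c * psum a n)).
  by congr (limn _); apply/funext => n; rewrite -psumZ.
apply/cvg_lim => //; apply: cvgM; first exact: cvg_cst.
by have /asboolP := l1P a.
Qed.

Lemma l1_coord_le (a : l1) n : rnorm (a n) <= l1_rnorm a.
Proof.
rewrite (le_trans _ (l1_psum_le a n.+1))// /series/= big_nat_recr//= lerDr.
by apply: sumr_ge0 => *; exact: rnorm_ge0.
Qed.

Lemma l1_norm0_eq0 (a : l1) : l1_norm a = 0 -> a = 0.
Proof.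
move=> /complexI a0; apply/val_inj/funext => n; apply: rnorm0_eq0.
by apply/eqP; rewrite eq_le rnorm_ge0 andbT (le_trans (l1_coord_le a n))// a0.
Qed.

HB.instance Definition _ :=
  Lmodule_isNormed.Build R[i] l1 l1_normD l1_normZ l1_norm0_eq0.

Lemma l1_complete (F : set_system l1) : ProperFilter F -> cauchy F -> cvg F.
Proof.
move=> FF Fc.
pose pr n : l1 -> R[i]^o := fun a : l1 => a n.
have cF n : cvg (pr n @ F).
  apply: complex_complete; apply: cauchy_lip => // a b.
  exact: (l1_coord_le (a - b)).
pose x n : R[i] := lim (pr n @ F).
have xP n (e : R) : 0 < e -> \forall b \near F, rnorm (x n - (b : l1) n) <= e.
  move=> e0; have e0' : 0 < e%:C by rewrite ltcR.
  move/cvgrPdist_le : (cF n) => /(_ _ e0'); apply: filterS => b.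
  by rewrite rnormE lecR.
have px n (e : R) : 0 < e -> \forall b \near F, psum (x - (b : l1)) n <= e.
  elim: n e => [|n IH] e e0; first by near=> b; rewrite /series/= big_geq// ltW.
  have e2 : 0 < e / 2 by rewrite divr_gt0.
  near=> b; rewrite /series/= big_nat_recr//= (splitr e) lerD//.
    by near: b; exact: IH.
  by near: b; exact: xP.
have [a Fa] := cauchy_rnorm FF Fc ltr01.
have xl1 : x \in l1_pred.
  apply: (@l1_predP _ (1 + 1 + l1_rnorm a)) => n.
  have [b [xb ab]] := filter_ex (filterI (px n 1 ltr01) Fa).
  have -> : x = (x - (b : l1)) + (l1_seq (b - a) + a).
    by apply/funext => i; rewrite !fctE/= !addrA !subrK.
  have ba : psum (l1_seq (b - a)) n <= rnorm (a - b).
    by rewrite rnormB; exact: l1_psum_le.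
  have := psumD (x - (b : l1)) (l1_seq (b - a) + a) n.
  have := psumD (l1_seq (b - a)) a n.
  have := l1_psum_le a n; move: ba ab xb; lra.
apply: (@cvg_sup_seminorm R l1 nat (fun n (a : l1) => psum a n) F (L1 xl1)) => //.
- by move=> *; exact: psumD.
- by move=> *; exact: l1_psum_le.
- by move=> y e _ ?; exact: psum_lim_le.
Unshelve. all: by end_near. Qed.

HB.instance Definition _ := Uniform_isComplete.Build l1 l1_complete.

Lemma l1_mul_subproof (a b : l1) :
  (fun n => a n * b n) \in l1_pred /\
  limn (psum (fun n => a n * b n)) <= l1_rnorm a * l1_rnorm b.
Proof.
suff h n : psum (fun n => a n * b n) n <= l1_rnorm a * l1_rnorm b.
  by split; [exact: l1_predP h|exact: psum_lim_le].
rewrite (@le_trans _ _ (psum a n * l1_rnorm b))//.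
  rewrite /series/= mulr_suml ler_sum// => i _.
  by rewrite rnormM ler_wpM2l ?rnorm_ge0// l1_coord_le.
by rewrite ler_wpM2r ?l1_rnorm_ge0// l1_psum_le.
Qed.

Definition l1_mul (a b : l1) : l1 := L1 (l1_mul_subproof a b).1.

Lemma l1_mulA : associative l1_mul.
Proof. by move=> a b c; apply/val_inj/funext => n /=; rewrite mulrA. Qed.

Lemma l1_mulDl : left_distributive l1_mul +%R.
Proof. by move=> a b c; apply/val_inj/funext => n /=; rewrite !fctE mulrDl. Qed.

Lemma l1_mulDr : right_distributive l1_mul +%R.
Proof. by move=> a b c; apply/val_inj/funext => n /=; rewrite !fctE mulrDr. Qed.

Lemma l1_mulZl (c : R[i]) (a b : l1) : l1_mul (c *: a) b = c *: l1_mul a b.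
Proof. by apply/val_inj/funext => n /=; rewrite !fctE -scalerAl. Qed.

Lemma l1_mulZr (c : R[i]) (a b : l1) : l1_mul a (c *: b) = c *: l1_mul a b.
Proof. by apply/val_inj/funext => n; exact: mulrCA. Qed.

Lemma l1_normM (a b : l1) : `|l1_mul a b| <= `|a| * `|b|.
Proof. by rewrite -rmorphM lecR; exact: (l1_mul_subproof a b).2. Qed.

HB.instance Definition _ := isBanachAlgebra.Build R l1
  l1_mulA l1_mulDl l1_mulDr l1_mulZl l1_mulZr l1_normM.

Lemma l1_delta_subproof (j : nat) : (fun n => (n == j)%:R : R[i]) \in l1_pred.
Proof.
apply: (@l1_predP _ 1) => n; elim: n => [|n IH]; first by rewrite /series/= big_geq.
have [->|nj] := eqVneq n j; last first.
  rewrite /series/= big_nat_recr//= (negPf nj) rnorm0 addr0; exact: IH.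
rewrite /series/= big_nat_recr//= eqxx big_nat_cond big1 ?add0r.
  by rewrite [rnorm _]rnorm_real normr1.
by move=> i /andP[/andP[_ ij] _]; rewrite (ltn_eqF ij) rnorm0.
Qed.

Definition l1_delta (j : nat) : l1 := L1 (l1_delta_subproof j).

End L1.

Section ClosedSubalgebra.
Variables (R : realType) (A : banachAlgType R).

Record closedSubalg := ClosedSubalg {
  csa_set :> set A ;
  csa0 : csa_set 0 ;
  csaP : forall (c : R[i]) x y, csa_set x -> csa_set y -> csa_set (c *: x + y) ;
  csaM : forall x y, csa_set x -> csa_set y -> csa_set (x ** y) ;
  csa_closed : closed csa_set }.

Variable S : closedSubalg.

Definition csa_pred : {pred A} := fun x => `[< csa_set S x >].

(* A closed subalgebra as a Banach algebra in its own right. *)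
Record csa_type := CsaType { csa_val :> A ; _ : csa_val \in csa_pred }.

HB.instance Definition _ := [isSub for csa_val].
HB.instance Definition _ := [Choice of csa_type by <:].

Lemma csa_submod_closed : submod_closed csa_pred.
Proof.
split; first exact/asboolP/csa0.
by move=> c x y /asboolP xS /asboolP yS; apply/asboolP/csaP.
Qed.

HB.instance Definition _ :=
  GRing.isSubmodClosed.Build R[i] A csa_pred csa_submod_closed.
HB.instance Definition _ := [SubChoice_isSubLmodule of csa_type by <:].

Lemma csa_valP (x : csa_type) : csa_set S x.
Proof. by case: x => x xP /=; have /asboolP := xP. Qed.

Lemma csa_normD (x y : csa_type) :
  `|csa_val (x + y)| <= `|csa_val x| + `|csa_val y|.
Proof. exact: ler_normD. Qed.

Lemma csa_normZ (c : R[i]) (x : csa_type) :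
  `|csa_val (c *: x)| = `|c| * `|csa_val x|.
Proof. exact: normrZ. Qed.

Lemma csa_norm0_eq0 (x : csa_type) : `|csa_val x| = 0 -> x = 0.
Proof. by move=> /eqP; rewrite normr_eq0 => /eqP x0; exact: val_inj. Qed.

HB.instance Definition _ :=
  Lmodule_isNormed.Build R[i] csa_type csa_normD csa_normZ csa_norm0_eq0.

Lemma csa_complete (F : set_system csa_type) :
  ProperFilter F -> cauchy F -> cvg F.
Proof.
move=> FF Fc.
have /cvg_ex[y Fy] : cvg (csa_val @ F).
  by apply: cauchy_cvg; apply: cauchy_lip.
have Sy : csa_set S y.
  apply: (@closed_cvg _ _ F FF csa_val (csa_set S) (@csa_closed S) _ _ Fy).
  by near=> x; exact: csa_valP.
have yP : y \in csa_pred by exact/asboolP.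
apply/cvg_ex; exists (CsaType yP); apply/cvgrPdist_le => e e0.
by move/cvgrPdist_le : Fy => /(_ _ e0).
Unshelve. all: by end_near. Qed.

HB.instance Definition _ := Uniform_isComplete.Build csa_type csa_complete.

Lemma csa_mul_subproof (x y : csa_type) : csa_val x ** csa_val y \in csa_pred.
Proof. by apply/asboolP/csaM; exact: csa_valP. Qed.

Definition csa_mul (x y : csa_type) : csa_type := CsaType (csa_mul_subproof x y).

Lemma csa_mulA : associative csa_mul.
Proof. by move=> x y z; apply: val_inj; exact: bmulA. Qed.

Lemma csa_mulDl : left_distributive csa_mul +%R.
Proof. by move=> x y z; apply: val_inj; exact: bmulDl. Qed.

Lemma csa_mulDr : right_distributive csa_mul +%R.
Proof. by move=> x y z; apply: val_inj; exact: bmulDr. Qed.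

Lemma csa_mulZl (c : R[i]) x y : csa_mul (c *: x) y = c *: csa_mul x y.
Proof. by apply: val_inj; exact: bmulZl. Qed.

Lemma csa_mulZr (c : R[i]) x y : csa_mul x (c *: y) = c *: csa_mul x y.
Proof. by apply: val_inj; exact: bmulZr. Qed.

Lemma csa_normM (x y : csa_type) : `|csa_mul x y| <= `|x| * `|y|.
Proof. exact: bnormM. Qed.

HB.instance Definition _ := isBanachAlgebra.Build R csa_type
  csa_mulA csa_mulDl csa_mulDr csa_mulZl csa_mulZr csa_normM.

End ClosedSubalgebra.

Section Linf.
Variables (R : realType) (I : Type) (X : I -> cstarAlgType R).

Definition linf_pred (x : forall i, X i) : bool :=
  `[< exists K : R, forall i, rnorm (x i) <= K >].

(* The l^infty-direct product of the C*-algebras X i. *)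
Record linf := Linf { linf_fun :> forall i, X i ; _ : linf_pred linf_fun }.

HB.instance Definition _ := [isSub for linf_fun].
HB.instance Definition _ := gen_eqMixin linf.
HB.instance Definition _ := gen_choiceMixin linf.

Implicit Types x y z : linf.

Lemma linf_eqP x y : (forall i, x i = y i) -> x = y.
Proof. by move=> xy; apply: val_inj; exact: functional_extensionality_dep. Qed.

Lemma linf_bounded x : exists K : R, forall i, rnorm (x i) <= K.
Proof. by case: x => x xP /=; have /asboolP := xP. Qed.

Lemma linf_predP (f : forall i, X i) (K : R) :
  (forall i, rnorm (f i) <= K) -> linf_pred f.
Proof. by move=> h; apply/asboolP; exists K. Qed.

Lemma linf_add_subproof x y : linf_pred (fun i => x i + y i).
Proof.
have [[K xK] [L yL]] := (linf_bounded x, linf_bounded y).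
by apply: (@linf_predP _ (K + L)) => i; rewrite (le_trans (rnormD _ _))// lerD.
Qed.

Lemma linf_scale_subproof (c : R[i]) x : linf_pred (fun i => c *: x i).
Proof.
have [K xK] := linf_bounded x.
apply: (@linf_predP _ (rnorm c * K)) => i.
by rewrite rnormZ; apply: ler_wpM2l; [exact: rnorm_ge0|exact: xK].
Qed.

Lemma linf_opp_subproof x : linf_pred (fun i => - x i).
Proof.
have [K xK] := linf_bounded x.
by apply: (@linf_predP _ K) => i; rewrite rnormN.
Qed.

Lemma linf_zero_subproof : linf_pred (fun i => 0).
Proof. by apply: (@linf_predP _ 0) => i; rewrite rnorm0. Qed.

Definition linf_add x y := Linf (linf_add_subproof x y).
Definition linf_scale c x := Linf (linf_scale_subproof c x).
Definition linf_opp x := Linf (linf_opp_subproof x).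
Definition linf_zero := Linf linf_zero_subproof.

Lemma linf_addA : associative linf_add.
Proof. by move=> x y z; apply: linf_eqP => i; exact: addrA. Qed.

Lemma linf_addC : commutative linf_add.
Proof. by move=> x y; apply: linf_eqP => i; exact: addrC. Qed.

Lemma linf_add0 : left_id linf_zero linf_add.
Proof. by move=> x; apply: linf_eqP => i; exact: add0r. Qed.

Lemma linf_addN : left_inverse linf_zero linf_opp linf_add.
Proof. by move=> x; apply: linf_eqP => i; exact: addNr. Qed.

HB.instance Definition _ :=
  GRing.isZmodule.Build linf linf_addA linf_addC linf_add0 linf_addN.

Lemma linf_scaleA c d x : linf_scale c (linf_scale d x) = linf_scale (c * d) x.
Proof. by apply: linf_eqP => i; exact: scalerA. Qed.

Lemma linf_scale1 : left_id 1 linf_scale.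
Proof. by move=> x; apply: linf_eqP => i; exact: scale1r. Qed.

Lemma linf_scaleDr : right_distributive linf_scale +%R.
Proof. by move=> c x y; apply: linf_eqP => i; exact: scalerDr. Qed.

Lemma linf_scaleDl x : {morph linf_scale^~ x : c d / c + d}.
Proof. by move=> c d; apply: linf_eqP => i; exact: scalerDl. Qed.

HB.instance Definition _ := GRing.Zmodule_isLmodule.Build R[i] linf
  linf_scaleA linf_scale1 linf_scaleDr linf_scaleDl.

Definition linf_rnorm x : R := sup (range (fun i => rnorm (x i))).
Definition linf_norm x : R[i] := (linf_rnorm x)%:C.

Lemma linf_coord_le x i : rnorm (x i) <= linf_rnorm x.
Proof.
have [K xK] := linf_bounded x.
by apply: ub_le_sup; [exists K => _ [j _ <-]|exists i].
Qed.

Lemma linf_rnorm_le x (K : R) : 0 <= K -> (forall i, rnorm (x i) <= K) ->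
  linf_rnorm x <= K.
Proof.
move=> K0 xK; have [r0|/nonemptyPn r0] :=
  pselect (range (fun i => rnorm (x i)) !=set0); last by rewrite /linf_rnorm r0 sup0.
by apply: ge_sup => // _ [i _ <-].
Qed.

Lemma linf_rnorm_ge0 x : 0 <= linf_rnorm x.
Proof.
have [[_ [i _ _]]|/nonemptyPn r0] :=
  pselect (range (fun i => rnorm (x i)) !=set0); last by rewrite /linf_rnorm r0 sup0.
by rewrite (le_trans (rnorm_ge0 (x i)))// linf_coord_le.
Qed.

Lemma linf_normD x y : linf_norm (x + y) <= linf_norm x + linf_norm y.
Proof.
rewrite -rmorphD/= lecR; apply: linf_rnorm_le => [|i].
  by rewrite addr_ge0// linf_rnorm_ge0.
by rewrite (le_trans (rnormD _ _))// lerD// linf_coord_le.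
Qed.

Lemma linf_normZ (c : R[i]) x : linf_norm (c *: x) = `|c| * linf_norm x.
Proof.
have le d z : linf_rnorm (d *: z) <= rnorm d * linf_rnorm z.
  apply: linf_rnorm_le => [|i]; first by rewrite mulr_ge0 ?rnorm_ge0 ?linf_rnorm_ge0.
  by rewrite rnormZ ler_wpM2l ?rnorm_ge0// linf_coord_le.
rewrite /linf_norm rnormE -rmorphM; congr (_%:C); apply/eqP.
rewrite eq_le le andTb; have [->|c0] := eqVneq c 0.
  by rewrite rnorm0 mul0r linf_rnorm_ge0.
have c0' : 0 < rnorm c.
  by rewrite lt_def rnorm_ge0 andbT; apply: contra c0 => /eqP/rnorm0_eq0->.
rewrite -ler_pdivlMl// (_ : (rnorm c)^-1 = rnorm c^-1).
  by rewrite -[in leLHS](scale1r x) -(mulVf c0) -scalerA le.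
by apply/eqP; rewrite -(inj_eq (mulfI (lt0r_neq0 c0'))) mulfV ?lt0r_neq0//
  -rnormM mulfV// [rnorm 1]rnorm_real normr1.
Qed.

Lemma linf_norm0_eq0 x : linf_norm x = 0 -> x = 0.
Proof.
move=> /complexI x0; apply: linf_eqP => i; apply: rnorm0_eq0.
by apply/eqP; rewrite eq_le rnorm_ge0 andbT -x0 linf_coord_le.
Qed.

HB.instance Definition _ :=
  Lmodule_isNormed.Build R[i] linf linf_normD linf_normZ linf_norm0_eq0.

Lemma linf_complete (F : set_system linf) : ProperFilter F -> cauchy F -> cvg F.
Proof.
move=> FF Fc.
have cF i : cvg ((fun x : linf => x i) @ F).
  apply: cauchy_cvg; apply: cauchy_lip => // x y.
  exact: (linf_coord_le (x - y)).
pose x i : X i := lim ((fun x : linf => x i) @ F).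
have xP i (e : R) : 0 < e -> \forall y \near F, rnorm (x i - (y : linf) i) <= e.
  move=> e0; have e0' : 0 < e%:C by rewrite ltcR.
  move/cvgrPdist_le : (cF i) => /(_ _ e0'); apply: filterS => y.
  by rewrite rnormE lecR.
have [a Fa] := cauchy_rnorm FF Fc ltr01.
have xl : linf_pred x.
  apply: (@linf_predP _ (1 + 1 + linf_rnorm a)) => i.
  have [y [xy ay]] := filter_ex (filterI (xP i 1 ltr01) Fa).
  have ya : rnorm ((y - a) i) <= rnorm (a - y).
    by rewrite [leRHS]rnormB; exact: (linf_coord_le (y - a) i).
  have := ler_rnormB (x i) (y i) (a i).
  have := rnormD (x i - a i) (a i); rewrite subrK.
  have := linf_coord_le a i.
  have -> : rnorm (y i - a i) = rnorm ((y - a) i) by [].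
  by move: ya ay xy; lra.
apply: (@cvg_sup_seminorm R linf I (fun i x => rnorm (x i)) F (Linf xl)) => //.
- by move=> *; exact: rnormD.
- by move=> *; exact: linf_coord_le.
- by move=> y e e0 ?; exact: linf_rnorm_le.
Qed.

HB.instance Definition _ := Uniform_isComplete.Build linf linf_complete.

Lemma linf_mul_subproof x y : linf_pred (fun i => x i ** y i).
Proof.
apply: (@linf_predP _ (linf_rnorm x * linf_rnorm y)) => i.
rewrite (@le_trans _ _ (rnorm (x i) * rnorm (y i)))//.
  by rewrite -lecR rmorphM/= -!rnormE bnormM.
by rewrite ler_pM ?rnorm_ge0 ?linf_coord_le.
Qed.

Definition linf_mul x y := Linf (linf_mul_subproof x y).

Lemma linf_mulA : associative linf_mul.
Proof. by move=> x y z; apply: linf_eqP => i; exact: bmulA. Qed.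

Lemma linf_mulDl : left_distributive linf_mul +%R.
Proof. by move=> x y z; apply: linf_eqP => i; exact: bmulDl. Qed.

Lemma linf_mulDr : right_distributive linf_mul +%R.
Proof. by move=> x y z; apply: linf_eqP => i; exact: bmulDr. Qed.

Lemma linf_mulZl (c : R[i]) x y : linf_mul (c *: x) y = c *: linf_mul x y.
Proof. by apply: linf_eqP => i; exact: bmulZl. Qed.

Lemma linf_mulZr (c : R[i]) x y : linf_mul x (c *: y) = c *: linf_mul x y.
Proof. by apply: linf_eqP => i; exact: bmulZr. Qed.

Lemma rnorm_bmul (A : banachAlgType R) (a b : A) :
  rnorm (a ** b) <= rnorm a * rnorm b.
Proof. by rewrite -lecR rmorphM/= -!rnormE bnormM. Qed.

Lemma linf_normM x y : `|linf_mul x y| <= `|x| * `|y|.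
Proof.
rewrite -rmorphM lecR; apply: linf_rnorm_le => [|i].
  by rewrite mulr_ge0 ?linf_rnorm_ge0.
by rewrite (le_trans (rnorm_bmul _ _))// ler_pM ?rnorm_ge0 ?linf_coord_le.
Qed.

HB.instance Definition _ := isBanachAlgebra.Build R linf
  linf_mulA linf_mulDl linf_mulDr linf_mulZl linf_mulZr linf_normM.

Lemma rnorm_cstar (A : cstarAlgType R) (a : A) :
  rnorm (star a ** a) = rnorm a ^+ 2.
Proof. by apply: complexI; rewrite rmorphXn/= -!rnormE cstar_identity. Qed.

Lemma rnorm_star_le (A : cstarAlgType R) (a : A) : rnorm (star a) <= rnorm a.
Proof.
have [a0|a0] := eqVneq (rnorm (star a)) 0; first by rewrite a0 rnorm_ge0.
have sa0 : 0 < rnorm (star a) by rewrite lt_def a0 rnorm_ge0.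
rewrite -(ler_pM2l sa0) -expr2 -rnorm_cstar starK mulrC.
exact: rnorm_bmul.
Qed.

Lemma linf_star_subproof x : linf_pred (fun i => star (x i)).
Proof.
apply: (@linf_predP _ (linf_rnorm x)) => i.
by rewrite (le_trans (rnorm_star_le _))// linf_coord_le.
Qed.

Definition linf_star x := Linf (linf_star_subproof x).

Lemma linf_starK : involutive linf_star.
Proof. by move=> x; apply: linf_eqP => i; exact: starK. Qed.

Lemma linf_starD : {morph linf_star : x y / x + y}.
Proof. by move=> x y; apply: linf_eqP => i; exact: starD. Qed.

Lemma linf_starZ (c : R[i]) x : linf_star (c *: x) = c^* *: linf_star x.
Proof. by apply: linf_eqP => i; exact: starZ. Qed.

Lemma linf_starM x y : linf_star (x ** y) = linf_star y ** linf_star x.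
Proof. by apply: linf_eqP => i; exact: starM. Qed.

Lemma linf_cstar_identity x : `|linf_star x ** x| = `|x| ^+ 2.
Proof.
rewrite -rmorphXn; congr (_%:C); apply/eqP; rewrite eq_le; apply/andP; split.
  apply: linf_rnorm_le => [|i]; first by rewrite exprn_ge0// linf_rnorm_ge0.
  by rewrite rnorm_cstar lerXn2r ?nnegrE ?rnorm_ge0 ?linf_rnorm_ge0 ?linf_coord_le.
rewrite -ler_sqrt ?linf_rnorm_ge0// sqrtr_sqr ger0_norm ?linf_rnorm_ge0//.
apply: linf_rnorm_le => [|i]; first exact: sqrtr_ge0.
rewrite -[leLHS]ger0_norm ?rnorm_ge0// -sqrtr_sqr ler_sqrt ?linf_rnorm_ge0//.
by rewrite -rnorm_cstar; exact: (linf_coord_le (linf_star x ** x)).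
Qed.

HB.instance Definition _ := isCstarAlgebra.Build R linf
  linf_starK linf_starD linf_starZ linf_starM linf_cstar_identity.

End Linf.

Section Matrices.
Variables (R : realType) (n : nat).

(* M_n with the C*-norm, that is the operator norm on l^2_n. *)
Definition cmat : Type := 'M[R[i]]_n.

HB.instance Definition _ := GRing.Lmodule.on cmat.

Definition l2n (v : 'cV[R[i]]_n) : R := Num.sqrt (\sum_i rnorm (v i 0) ^+ 2).

Definition cmat_rnorm (A : cmat) : R := opn l2n l2n (mulmx A).
Definition cmat_norm (A : cmat) : R[i] := (cmat_rnorm A)%:C.

Implicit Types v w : 'cV[R[i]]_n.

Lemma l2n_ge0 v : 0 <= l2n v. Proof. exact: sqrtr_ge0. Qed.

Lemma l2n_sqr v : l2n v ^+ 2 = \sum_i rnorm (v i 0) ^+ 2.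
Proof. by rewrite sqr_sqrtr// sumr_ge0// => i _; rewrite exprn_ge0// rnorm_ge0. Qed.

Lemma l2n0 : l2n 0 = 0.
Proof.
by rewrite /l2n big1 ?sqrtr0// => i _; rewrite mxE [rnorm _]rnorm0 expr0n.
Qed.

Lemma l2nZ c v : l2n (c *: v) = rnorm c * l2n v.
Proof.
rewrite /l2n -[in RHS](ger0_norm (rnorm_ge0 c)) -sqrtr_sqr -sqrtrM ?exprn_ge0 ?rnorm_ge0//.
by congr Num.sqrt; rewrite mulr_sumr; apply: eq_bigr => i _; rewrite mxE rnormM exprMn.
Qed.

Definition cinner (v w : 'cV[R[i]]_n) : R[i] := \sum_i v i 0 * (w i 0)^*.

Lemma cinnerE v w : cinner v w = dotmx v^T w^T.
Proof.
rewrite dotmxE mxE; apply: eq_bigr => i _.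
by rewrite !mxE.
Qed.

Lemma cinner_sqr v : cinner v v = (l2n v)%:C ^+ 2.
Proof.
rewrite -rmorphXn l2n_sqr/= rmorph_sum; apply: eq_bigr => i _.
by rewrite /= rmorphXn/= -rnormE -normCK.
Qed.

Lemma sqrtC_cinner v : sqrtC (dotmx v^T v^T) = (l2n v)%:C.
Proof. by rewrite -cinnerE cinner_sqr sqrCK// ler0c l2n_ge0. Qed.

Lemma cinner_le v w : rnorm (cinner v w) <= l2n v * l2n w.
Proof.
rewrite -lecR rmorphM/= -rnormE -!sqrtC_cinner cinnerE.
exact: (CauchySchwarz_sqrt (@dotmx _ n) v^T w^T).1.
Qed.

Lemma l2nD v w : l2n (v + w) <= l2n v + l2n w.
Proof.
rewrite -lecR rmorphD/= -!sqrtC_cinner linearD/=.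
exact: (triangle_lerif (@dotmx _ n) v^T w^T).1.
Qed.

Lemma coord_l2n v i : rnorm (v i 0) <= l2n v.
Proof.
rewrite -[leLHS]ger0_norm ?rnorm_ge0// -sqrtr_sqr ler_sqrt.
  rewrite (bigD1 i)//= lerDl sumr_ge0// => j _.
  by rewrite exprn_ge0// rnorm_ge0.
by rewrite sumr_ge0// => j _; rewrite exprn_ge0// rnorm_ge0.
Qed.

Lemma l2n_sum v : l2n v <= \sum_i rnorm (v i 0).
Proof.
have s0 : 0 <= \sum_i rnorm (v i 0) by rewrite sumr_ge0// => i _; rewrite rnorm_ge0.
rewrite -[leRHS]ger0_norm// -sqrtr_sqr ler_sqrt ?exprn_ge0//.
rewrite expr2 mulr_suml ler_sum// => i _; rewrite expr2 ler_wpM2l ?rnorm_ge0//.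
by rewrite (bigD1 i)//= lerDl sumr_ge0// => j _; rewrite rnorm_ge0.
Qed.

Lemma l2n0_eq0 v : l2n v = 0 -> v = 0.
Proof.
move=> v0; apply/colP => i; rewrite mxE; apply: rnorm0_eq0.
by apply/eqP; rewrite eq_le rnorm_ge0 andbT -v0 coord_l2n.
Qed.

Implicit Types A B : cmat.

Definition cmat_esum A : R := \sum_i \sum_j rnorm (A i j).

Lemma cmat_esum_ge0 A : 0 <= cmat_esum A.
Proof. by apply: sumr_ge0 => i _; apply: sumr_ge0 => j _; exact: rnorm_ge0. Qed.

Lemma cmat_bounded A v : l2n (mulmx A v) <= cmat_esum A * l2n v.
Proof.
rewrite (le_trans (l2n_sum _))// /cmat_esum mulr_suml ler_sum// => i _.
rewrite mxE (le_trans (rnorm_sum _ _ _))// mulr_suml ler_sum// => j _.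
by rewrite rnormM ler_wpM2l ?rnorm_ge0// coord_l2n.
Qed.

Lemma cmat_ge A v : l2n (mulmx A v) <= cmat_rnorm A * l2n v.
Proof.
exact: (opn_ge l2n_ge0 l2nZ l2nZ v (cmat_bounded A)).
Qed.

Lemma cmat_le A K : 0 <= K -> (forall v, l2n (mulmx A v) <= K * l2n v) ->
  cmat_rnorm A <= K.
Proof. exact: (opn_le l2n0). Qed.

Lemma cmat_rnorm_ge0 A : 0 <= cmat_rnorm A.
Proof. exact: (opn_ge0 l2n0 l2n_ge0 l2n_ge0 (cmat_bounded A)). Qed.

Lemma cmat_normD A B : cmat_norm (A + B) <= cmat_norm A + cmat_norm B.
Proof.
rewrite -rmorphD/= lecR; apply: cmat_le => [|v].
  by rewrite addr_ge0// cmat_rnorm_ge0.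
by rewrite mulrDl mulmxDl (le_trans (l2nD _ _))// lerD// cmat_ge.
Qed.

Lemma cmat_normZ (c : R[i]) A : cmat_norm (c *: A) = `|c| * cmat_norm A.
Proof.
have le d B : cmat_rnorm (d *: B) <= rnorm d * cmat_rnorm B.
  apply: cmat_le => [|v]; first by rewrite mulr_ge0 ?rnorm_ge0 ?cmat_rnorm_ge0.
  by rewrite -scalemxAl l2nZ -mulrA ler_wpM2l ?rnorm_ge0// cmat_ge.
rewrite /cmat_norm rnormE -rmorphM; congr (_%:C); apply/eqP.
rewrite eq_le le andTb; have [->|c0] := eqVneq c 0.
  by rewrite rnorm0 mul0r cmat_rnorm_ge0.
have c0' : 0 < rnorm c.
  by rewrite lt_def rnorm_ge0 andbT; apply: contra c0 => /eqP/rnorm0_eq0->.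
rewrite -ler_pdivlMl// (_ : (rnorm c)^-1 = rnorm c^-1).
  by rewrite -[in leLHS](scale1r A) -(mulVf c0) -scalerA le.
by apply/eqP; rewrite -(inj_eq (mulfI (lt0r_neq0 c0'))) mulfV ?lt0r_neq0//
  -rnormM mulfV// [rnorm 1]rnorm_real normr1.
Qed.

Lemma cmat_entry_le A i j : rnorm (A i j) <= cmat_rnorm A.
Proof.
have d1 : l2n (delta_mx j 0) = 1.
  rewrite /l2n (bigD1 j)//= mxE !eqxx [rnorm _]rnorm_real normr1 expr1n.
  rewrite big1 ?addr0 ?sqrtr1// => k kj.
  by rewrite mxE (negPf kj) [rnorm _]rnorm0 expr0n.
have -> : A i j = (mulmx A (delta_mx j 0) : 'cV_n) i 0.
  by rewrite -colE mxE.
by rewrite (le_trans (coord_l2n _ _))// (le_trans (cmat_ge _ _))// d1 mulr1.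
Qed.

Lemma cmat_norm0_eq0 A : cmat_norm A = 0 -> A = 0.
Proof.
move=> /complexI A0; apply/matrixP => i j; rewrite mxE; apply: rnorm0_eq0.
by apply/eqP; rewrite eq_le rnorm_ge0 andbT -A0 cmat_entry_le.
Qed.

HB.instance Definition _ :=
  Lmodule_isNormed.Build R[i] cmat cmat_normD cmat_normZ cmat_norm0_eq0.

Lemma cmat_complete (F : set_system cmat) : ProperFilter F -> cauchy F -> cvg F.
Proof.
move=> FF Fc.
pose pr i j : cmat -> R[i]^o := fun A => A i j.
have cF i j : cvg (pr i j @ F).
  apply: complex_complete; apply: cauchy_lip => // A B.
  rewrite (_ : pr i j A - pr i j B = (A - B : cmat) i j).
    exact: (cmat_entry_le (A - B)).
  by rewrite /pr !mxE.
pose X : cmat := \matrix_(i, j) lim (pr i j @ F).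
apply/cvg_ex; exists X; apply: cvg_rnorm => e e0.
pose d := e / (n * n).+1%:R.
have d0 : 0 < d by rewrite divr_gt0.
have XP i j : \forall A \near F, rnorm ((X - A : cmat) i j) <= d.
  have d0' : 0 < d%:C by rewrite ltcR.
  move/cvgrPdist_le : (cF i j) => /(_ _ d0'); apply: filterS => A.
  by rewrite !mxE rnormE lecR.
have : \forall A \near F, forall i j, rnorm ((X - A : cmat) i j) <= d.
  have h i : \forall A \near F, forall j, rnorm ((X - A : cmat) i j) <= d.
    exact: filter_forall.
  exact: filter_forall.
apply: filterS => A Ad.
have : cmat_rnorm (X - A) <= cmat_esum (X - A).
  by apply: cmat_le; [exact: cmat_esum_ge0|exact: cmat_bounded].
move=> /le_trans; apply.
rewrite (@le_trans _ _ (\sum_(i < n) \sum_(j < n) d))//.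
  by apply: ler_sum => i _; apply: ler_sum => j _.
rewrite !sumr_const !card_ord -mulrnA -[leLHS]mulr_natr /d mulrAC ler_pdivrMr//.
by apply: ler_wpM2l; [exact: ltW|rewrite ler_nat].
Qed.

HB.instance Definition _ := Uniform_isComplete.Build cmat cmat_complete.

Definition cmat_mul (A B : cmat) : cmat := A *m B.

Lemma cmat_mulA : associative cmat_mul.
Proof. by move=> A B D; exact: mulmxA. Qed.

Lemma cmat_mulDl : left_distributive cmat_mul +%R.
Proof. by move=> A B D; exact: mulmxDl. Qed.

Lemma cmat_mulDr : right_distributive cmat_mul +%R.
Proof. by move=> A B D; exact: mulmxDr. Qed.

Lemma cmat_mulZl (c : R[i]) A B : cmat_mul (c *: A) B = c *: cmat_mul A B.
Proof. exact/esym/scalemxAl. Qed.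

Lemma cmat_mulZr (c : R[i]) A B : cmat_mul A (c *: B) = c *: cmat_mul A B.
Proof. exact/esym/scalemxAr. Qed.

Lemma cmat_normM A B : `|cmat_mul A B| <= `|A| * `|B|.
Proof.
rewrite -rmorphM lecR; apply: cmat_le => [|v].
  by rewrite mulr_ge0 ?cmat_rnorm_ge0.
rewrite -mulmxA (le_trans (cmat_ge _ _))// -mulrA.
by rewrite ler_wpM2l ?cmat_rnorm_ge0// cmat_ge.
Qed.

HB.instance Definition _ := isBanachAlgebra.Build R cmat
  cmat_mulA cmat_mulDl cmat_mulDr cmat_mulZl cmat_mulZr cmat_normM.

Definition cmat_star (A : cmat) : cmat := A ^t*.

Lemma cmat_starK : involutive cmat_star.
Proof. by move=> A; exact: trmxCK. Qed.

Lemma cmat_starD : {morph cmat_star : A B / A + B}.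
Proof. by move=> A B; rewrite /cmat_star linearD/= map_mxD. Qed.

Lemma cmat_starZ (c : R[i]) A : cmat_star (c *: A) = c^* *: cmat_star A.
Proof. by rewrite /cmat_star linearZ/= map_mxZ. Qed.

Lemma cmat_starM A B : cmat_star (A ** B) = cmat_star B ** cmat_star A.
Proof. by rewrite /cmat_star trmx_mul map_mxM. Qed.

Lemma cinner_star A v w : cinner (mulmx A v) w = cinner v (mulmx (cmat_star A) w).
Proof.
rewrite /cinner.
under eq_bigr do rewrite mxE mulr_suml.
rewrite exchange_big/=; apply: eq_bigr => j _; rewrite mxE rmorph_sum mulr_sumr.
by apply: eq_bigr => i _; rewrite !mxE rmorphM/= conjCK mulrCA mulrA.
Qed.

Lemma cmat_sqr_le A v :
  l2n (mulmx A v) ^+ 2 <= cmat_rnorm (cmat_star A ** A) * l2n v ^+ 2.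
Proof.
have -> : l2n (mulmx A v) ^+ 2 = rnorm (cinner (mulmx A v) (mulmx A v)).
  by rewrite cinner_sqr -rmorphXn rnorm_real ger0_norm// exprn_ge0// l2n_ge0.
rewrite cinner_star (le_trans (cinner_le _ _))// mulmxA mulrC expr2 mulrA.
by rewrite ler_wpM2r ?l2n_ge0//; exact: cmat_ge.
Qed.

Lemma cmat_sqr_le2 A : cmat_rnorm A ^+ 2 <= cmat_rnorm (cmat_star A ** A).
Proof.
rewrite -ler_sqrt ?cmat_rnorm_ge0// sqrtr_sqr ger0_norm ?cmat_rnorm_ge0//.
apply: cmat_le => [|v]; first exact: sqrtr_ge0.
rewrite -[leLHS]ger0_norm ?l2n_ge0// -[l2n v in leRHS]ger0_norm ?l2n_ge0//.
rewrite -!sqrtr_sqr -sqrtrM ?cmat_rnorm_ge0// ler_sqrt ?cmat_sqr_le//.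
by rewrite mulr_ge0 ?cmat_rnorm_ge0// exprn_ge0// l2n_ge0.
Qed.

Lemma cmat_rnormM A B : cmat_rnorm (A ** B) <= cmat_rnorm A * cmat_rnorm B.
Proof. by rewrite -lecR rmorphM; exact: cmat_normM. Qed.

Lemma cmat_rnorm_star A : cmat_rnorm A <= cmat_rnorm (cmat_star A).
Proof.
have [a0|a0] := eqVneq (cmat_rnorm A) 0; first by rewrite a0 cmat_rnorm_ge0.
have a0' : 0 < cmat_rnorm A by rewrite lt_def a0 cmat_rnorm_ge0.
rewrite -(ler_pM2r a0') -expr2 (le_trans (cmat_sqr_le2 A))//.
exact: cmat_rnormM.
Qed.

Lemma cmat_cstar_identity A : `|cmat_star A ** A| = `|A| ^+ 2.
Proof.
rewrite -rmorphXn; congr (_%:C); apply/eqP; rewrite eq_le cmat_sqr_le2 andbT.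
rewrite (le_trans (cmat_rnormM _ _))// expr2 ler_wpM2r ?cmat_rnorm_ge0//.
by rewrite -[in leRHS](cmat_starK A) cmat_rnorm_star.
Qed.

HB.instance Definition _ := isCstarAlgebra.Build R cmat
  cmat_starK cmat_starD cmat_starZ cmat_starM cmat_cstar_identity.

End Matrices.

Section Operators.
Variable R : realType.

Lemma blin_of_subproof (E F : normedModType R[i]) (f : E -> F) (K : R) :
  linear f -> (forall x, rnorm (f x) <= K * rnorm x) -> f \in @blin_pred R E F.
Proof. by move=> fl fK; apply/asboolP; split; [|exists K]. Qed.

Lemma comp_subproof (E F G : normedModType R[i]) (g : blin F G) (f : blin E F) :
  (g \o f) \in @blin_pred R E G.
Proof.
apply: (@blin_of_subproof _ _ _ (rnorm g * rnorm f)) => [c x y|x] /=.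
  by rewrite !linearP.
apply: (le_trans (blin_rnorm_ge g (f x))); rewrite -mulrA.
by apply: ler_wpM2l; [exact: rnorm_ge0|exact: blin_rnorm_ge].
Qed.

Definition blin_comp E F G (g : blin F G) (f : blin E F) : blin E G :=
  Blin (comp_subproof g f).

Lemma blin_comp_le E F G (g : blin F G) (f : blin E F) :
  rnorm (blin_comp g f) <= rnorm g * rnorm f.
Proof.
apply: blin_opn_le => [|x]; first by rewrite mulr_ge0 ?rnorm_ge0.
apply: (le_trans (blin_rnorm_ge g (f x))); rewrite -mulrA.
by apply: ler_wpM2l; [exact: rnorm_ge0|exact: blin_rnorm_ge].
Qed.

Lemma precomp_subproof (E F G : normedModType R[i]) (f : blin E F) :
  (fun g : blin F G => blin_comp g f) \in @blin_pred R (blin F G) (blin E G).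
Proof.
apply: (@blin_of_subproof _ _ _ (rnorm f)) => [c g h|g].
  by apply/val_inj/funext => x.
by rewrite mulrC; exact: blin_comp_le.
Qed.

Definition precomp E F (G : normedModType R[i]) (f : blin E F) :
  blin (blin F G) (blin E G) := Blin (precomp_subproof G f).

Definition adjoint E F (f : blin E F) : blin (dual F) (dual E) :=
  precomp R[i]^o f.

Lemma eval_subproof (E : normedModType R[i]) (x : E) :
  (fun f : dual E => f x : R[i]^o) \in @blin_pred R (dual E) R[i]^o.
Proof.
apply: (@blin_of_subproof _ _ _ (rnorm x)) => [c g h//|g].
by rewrite mulrC; exact: blin_rnorm_ge.
Qed.

Definition kappa (E : normedModType R[i]) (x : E) : dual (dual E) :=
  Blin (eval_subproof x).

Lemma lmul_subproof (A : banachAlgType R) (a : A) :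
  (fun x => a ** x) \in @blin_pred R A A.
Proof.
apply: (@blin_of_subproof _ _ _ (rnorm a)) => [c x y|x].
  by rewrite bmulDr bmulZr.
exact: rnorm_bmul.
Qed.

Definition lmul (A : banachAlgType R) (a : A) : blin A A := Blin (lmul_subproof a).

Lemma rmul_subproof (A : banachAlgType R) (a : A) :
  (fun x => x ** a) \in @blin_pred R A A.
Proof.
apply: (@blin_of_subproof _ _ _ (rnorm a)) => [c x y|x].
  by rewrite bmulDl bmulZl.
by rewrite mulrC; exact: rnorm_bmul.
Qed.

Definition rmul (A : banachAlgType R) (a : A) : blin A A := Blin (rmul_subproof a).

Lemma bilin_mul_subproof (A : banachAlgType R) :
  (fun a : A => lmul a) \in @blin_pred R A (blin A A).
Proof.
apply: (@blin_of_subproof _ _ _ 1) => [c a b|a].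
  by apply/val_inj/funext => x; rewrite /= bmulDl bmulZl.
by rewrite mul1r; apply: blin_opn_le => [|x];
  [exact: rnorm_ge0|exact: rnorm_bmul].
Qed.

Definition bilin_mul (A : banachAlgType R) : blin A (blin A A) :=
  Blin (bilin_mul_subproof A).

End Operators.

(* The projective tensor product of Banach spaces E and F, by its universal
   property: each bounded bilinear map f from E x F to a Banach space, given in
   curried form, has a unique bounded linear factorization through
   (x, y) |-> x (x) y, and its norm is at most the norm of f. *)
Record projTensor (R : realType) (E F : completeNormedModType R[i]) := ProjTensor {
  pt_space :> completeNormedModType R[i] ;
  pt_map : blin E (blin F pt_space) ;
  pt_map_norm : forall x y, `|pt_map x y| <= `|x| * `|y| ;
  pt_lift : forall G : completeNormedModType R[i],
    blin E (blin F G) -> blin pt_space G ;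
  pt_liftE : forall (G : completeNormedModType R[i]) (f : blin E (blin F G)) x y,
    pt_lift f (pt_map x y) = f x y ;
  pt_lift_norm : forall (G : completeNormedModType R[i]) (f : blin E (blin F G)),
    `|pt_lift f| <= `|f| ;
  pt_lift_uniq : forall (G : completeNormedModType R[i]) (f : blin E (blin F G))
    (g : blin pt_space G), (forall x y, g (pt_map x y) = f x y) -> g = pt_lift f }.

Section Biflat.
Variables (R : realType) (A : banachAlgType R) (P : projTensor A A).

(* b (x) c |-> b c *)
Definition pt_pi : blin P A := pt_lift P (bilin_mul A).

(* b (x) c |-> a b (x) c *)
Definition pt_lact (a : A) : blin P P :=
  pt_lift P (blin_comp (pt_map P) (lmul a)).

(* b (x) c |-> b (x) c a *)
Definition pt_ract (a : A) : blin P P :=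
  pt_lift P (blin_comp (precomp P (rmul a)) (pt_map P)).

(* The bimodule actions on the bidual of P are the second adjoints of the
   actions on P. *)
Definition biflat_splitting (sigma : blin A (dual (dual P))) : Prop :=
  [/\ forall a b, sigma (a ** b) = adjoint (adjoint (pt_lact a)) (sigma b),
      forall a b, sigma (a ** b) = adjoint (adjoint (pt_ract b)) (sigma a) &
      forall a, adjoint (adjoint pt_pi) (sigma a) = kappa a].

End Biflat.

Definition biflat (R : realType) (A : banachAlgType R) : Prop :=
  exists (P : projTensor A A) (sigma : blin A (dual (dual P))),
    biflat_splitting sigma.

Record banachBimodule (R : realType) (A : banachAlgType R) := BanachBimodule {
  bm_space :> completeNormedModType R[i] ;
  bm_lact : blin A (blin bm_space bm_space) ;
  bm_ract : blin A (blin bm_space bm_space) ;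
  bm_lactM : forall a b x, bm_lact (a ** b) x = bm_lact a (bm_lact b x) ;
  bm_ractM : forall a b x, bm_ract (a ** b) x = bm_ract b (bm_ract a x) ;
  bm_lract : forall a b x, bm_lact a (bm_ract b x) = bm_ract b (bm_lact a x) }.

Section Amenable.
Variables (R : realType) (A : banachAlgType R) (X : banachBimodule A).

(* The dual bimodule: (a . f) x = f (x . a) and (f . a) x = f (a . x). *)
Definition dual_lact (a : A) (f : dual X) : dual X := adjoint (bm_ract X a) f.
Definition dual_ract (a : A) (f : dual X) : dual X := adjoint (bm_lact X a) f.

Definition derivation (D : blin A (dual X)) : Prop :=
  forall a b, D (a ** b) = dual_lact a (D b) + dual_ract b (D a).

Definition inner_derivation (D : blin A (dual X)) : Prop :=
  exists f : dual X, forall a, D a = dual_lact a f - dual_ract a f.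

End Amenable.

(* Johnson's definition: H^1(A, X') = 0 for each Banach A-bimodule X. *)
Definition amenable (R : realType) (A : banachAlgType R) : Prop :=
  forall (X : banachBimodule A) (D : blin A (dual X)),
    derivation D -> inner_derivation D.

Section BanachAlgebraProperties.
Variables (R : realType) (A : banachAlgType R).

Definition singly_generated : Prop := exists b : A,
  \bigcap_(S in [set S : closedSubalg A | csa_set S b]) csa_set S = setT.

Definition left_ideal (L : set A) : Prop :=
  [/\ L 0, forall (c : R[i]) x y, L x -> L y -> L (c *: x + y) &
      forall a x, L x -> L (a ** x)].

Definition modular (L : set A) : Prop := exists u, forall a, L (a - a ** u).

Definition maximal_modular_left_ideal (L : set A) : Prop :=
  [/\ left_ideal L, modular L, L <> setT &
      forall L' : set A, left_ideal L' -> L `<=` L' -> L' = L \/ L' = setT].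

Definition jacobson_radical : set A :=
  \bigcap_(L in maximal_modular_left_ideal) L.

Definition semisimple : Prop := jacobson_radical = [set 0].

Definition is_identity (e : A) : Prop := forall x, e ** x = x /\ x ** e = x.

End BanachAlgebraProperties.

Section VonNeumann.
Variables (R : realType) (A : cstarAlgType R).

Definition is_predual (E : completeNormedModType R[i]) : Prop :=
  exists T : blin A (dual E),
    (forall x, `|T x| = `|x|) /\ (forall f, exists x, T x = f).

(* Sakai's characterization: the C*-algebras that are dual Banach spaces. *)
Definition von_neumann_algebra : Prop := exists E, is_predual E.

Definition separable_predual : Prop :=
  exists2 E, is_predual E & exists2 D : set E, countable D & dense D.

Definition projection (p : A) : Prop := star p = p /\ p ** p = p.

Definition central (z : A) : Prop := forall x, z ** x = x ** z.

Definition abelian_projection (p : A) : Prop := projection p /\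
  forall x y, (p ** x ** p) ** (p ** y ** p) = (p ** y ** p) ** (p ** x ** p).

Definition finite_algebra : Prop := exists2 e : A, is_identity e &
  forall u, star u ** u = e -> u ** star u = e.

Definition type_I : Prop := forall z : A, projection z -> central z -> z <> 0 ->
  exists p : A, [/\ abelian_projection p, p <> 0 & p ** z = p].

End VonNeumann.

(* S together with the two symbols alpha and omega. *)
Definition ext (S : Type) : Type := option (option S).
Definition ext_alpha S : ext S := None.
Definition ext_omega S : ext S := Some None.
Definition ext_pt S (s : S) : ext S := Some (Some s).

Section Example.
Variable R : realType.

Definition basis_vec (p q : ext nat) : R[i] := (q == p :> option (option nat))%:R.

Definition x_vec (n : nat) (q : ext nat) : R[i] :=
  basis_vec (ext_omega _) q + basis_vec (ext_alpha _) q + basis_vec (ext_pt n) q.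

Definition y_vec (n : nat) (q : ext nat) : R[i] :=
  basis_vec (ext_omega _) q - basis_vec (ext_alpha _) q + basis_vec (ext_pt n) q.

(* The (p, q) matrix coefficient <E_n e_q, e_p> of E_n xi = <xi, x_n> y_n. *)
Definition E_coef (n : nat) (p q : ext nat) : R[i] := y_vec n p * (x_vec n q)^*.

Definition extF (F : {fset nat}) : finType := option (option F).

Definition extF_incl (F : {fset nat}) (p : extF F) : ext nat :=
  omap (omap val) p.

(* M_{F u {alpha, omega}}, with rows and columns enumerated by enum_val. *)
Definition matF (F : {fset nat}) : cstarAlgType R := cmat R #|extF F|.

Definition E_mat (F : {fset nat}) (n : nat) : matF F :=
  \matrix_(i, k) E_coef n (extF_incl (enum_val i)) (extF_incl (enum_val k)).

Definition nefset : Type := {F : {fset nat} | F != fset0}.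

Definition prodM : cstarAlgType R := linf (fun F : nefset => matF (val F)).

Definition is_phi (phi : blin (l1 R) prodM) : Prop :=
  forall (j : nat) (F : nefset),
    linf_fun (phi (l1_delta R j)) F = if j \in val F then E_mat (val F) j else 0.

End Example.

(* Main.v *)
(* Evaluating the matrix coefficient of phi(a)_F at (omega, alpha) gives the sum
   of a over F, so the lower bound reduces to the inequality
   sum |z_i| <= pi sup_P |sum_(i in P) z_i|, obtained by averaging
   sum_i Re(e^(-i theta) z_i)^+ over the angles theta = k pi / m, m -> oo.
   Hence phi(A) is isomorphic to l^1(N), and the other properties concern any
   Banach algebra B isomorphic to l^1(N):
   - semisimple: the kernels of the coordinates are maximal modular ideals;
   - singly generated by sum_j 3^-j delta_j, whose tails, once rescaled, have
     powers converging to the successive delta_j;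
   - biflat: delta_j |-> delta_j (x) delta_j is even a splitting B -> B (x) B,
     where B (x) B is l^1(N x N) with an equivalent norm;
   - not amenable: for X = B' with a . x = 0, kappa : B -> X' is a derivation,
     and it is not inner because B has no bounded approximate identity.
   The predual of M is the closed span in M' of the matrix coefficients. *)
Require Import Defs.
From HB Require Import structures.
From mathcomp Require Import all_boot all_order all_algebra complex finmap ring lra.
From mathcomp Require Import all_classical all_reals topology normedtype derive.
From mathcomp Require Import trigo sequences.
Set Implicit Arguments.
Unset Strict Implicit.
Unset Printing Implicit Defensive.
Import Order.TTheory GRing.Theory Num.Theory.
Import numFieldNormedType.Exports.
Local Open Scope classical_set_scope.
Local Open Scope complex_scope.
Local Open Scope ring_scope.

(** The vectors are chosen so that <y_n, x_m> = 1 - 1 + [m = n]: the contributions of omega and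
    alpha cancel, which makes the E_n orthogonal idempotents although all of them share the entry 1
    at (omega, alpha). Through this shared entry the norm of phi(a) controls plain sums of
    coefficients, and letting F run over all finite sets yields every subset sum. The constant 3 is
    the product of the two lengths sqrt 3; pi appears because cos^+ has mean 1/pi over the circle.
    The estimates give an isomorphism with l^1(N) and no isometry. This matters for the tensor
    product, whose norm inequalities are required exactly for the norm of B, so that the norm of
    l^1(N x N) itself will not do. For the predual, a closed subspace of M' becomes a Banach space
    by the construction of closed subalgebras, once M' is given the product 0. *)

(** * Approximation in norm and spaces of bounded operators *)

Section Approximation.
Variables (R : realType) (V : normedModType R[i]).

Lemma rnorm_lt_ball (x y : V) (e : R) : ball x e%:C y <-> rnorm (x - y) < e.
Proof. by rewrite -ball_normE/= rnormE ltcR. Qed.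

Lemma closure_rnormP (S : set V) (x : V) :
  closure S x <-> forall e : R, 0 < e -> exists2 y, S y & rnorm (x - y) <= e.
Proof.
split=> [Sx e e0|h B /nbhs_ballP[e /= e0]].
  have e0' : 0 < e%:C by rewrite ltcR.
  have [y [Sy /rnorm_lt_ball xy]] := Sx _ (nbhsx_ballx x _ e0').
  by exists y => //; exact: ltW.
have eR : e = (complex.Re e)%:C by rewrite RRe_real// gtr0_real.
have Re0 : 0 < complex.Re e by move: e0; rewrite ltcE => /andP[].
have [y Sy xy] := h _ (divr_gt0 Re0 (ltr0n _ 2)).
move=> sB; exists y; split => //; apply: sB; rewrite eR; apply/rnorm_lt_ball.
by rewrite (le_lt_trans xy)//; lra.
Qed.

Lemma closed_rnorm (S : set V) :
  (forall x, (forall e : R, 0 < e -> exists2 y, S y & rnorm (x - y) <= e) -> S x) ->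
  closed S.
Proof. by move=> h x /closure_rnormP/h. Qed.

Lemma rnorm_le_eq (x y : V) : (forall e : R, 0 < e -> rnorm (x - y) <= e) -> x = y.
Proof.
move=> h; apply/eqP; rewrite -subr_eq0; apply/eqP/rnorm0_eq0.
apply/eqP; rewrite eq_le rnorm_ge0 andbT; apply/ler_addgt0Pr => e e0.
by rewrite add0r h.
Qed.

End Approximation.

Lemma blin_scaleE (R : realType) (E F : normedModType R[i]) (c : R[i])
  (f : blin E F) x : (c *: f) x = c *: f x.
Proof. by []. Qed.

Lemma blinZ (R : realType) (E F : normedModType R[i]) (f : blin E F) c x :
  f (c *: x) = c *: f x.
Proof. exact: linearZ_LR. Qed.

Lemma blinB (R : realType) (E F : normedModType R[i]) (f : blin E F) x y :
  f (x - y) = f x - f y.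
Proof. exact: linearB. Qed.

Section LinearBounds.
Variables (R : realType) (V W : normedModType R[i]).

(* The bound is replaced by a positive one, so that it can be divided by. *)
Lemma blin_pos_bound (f : blin V W) :
  exists2 K : R, 0 < K & forall x, rnorm (f x) <= K * rnorm x.
Proof.
exists (rnorm f + 1) => [|x]; first by rewrite ltr_wpDl ?rnorm_ge0.
by rewrite (le_trans (blin_rnorm_ge f x))// ler_wpM2r ?rnorm_ge0// lerDl.
Qed.

Lemma cauchy_lipschitz (f : V -> W) (K : R) (F : set_system V) :
  (forall x y, rnorm (f x - f y) <= K * rnorm (x - y)) -> ProperFilter F ->
  cauchy F -> cauchy (f @ F).
Proof.
move=> fl FF Fc; apply/cauchyP => e e0.
have eR : e = (complex.Re e)%:C by rewrite RRe_real// gtr0_real.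
have Re0 : 0 < complex.Re e by move: e0; rewrite ltcE => /andP[].
have K1 : 0 < `|K| + 1 by rewrite ltr_wpDl.
have [a Fa] := cauchy_rnorm FF Fc (divr_gt0 (divr_gt0 Re0 K1) (ltr0n _ 2)).
exists (f a); apply: filterS Fa => b ab /=.
rewrite eR; apply/rnorm_lt_ball; apply: le_lt_trans (fl _ _) _.
have /le_lt_trans : K * rnorm (a - b) <= (`|K| + 1) * rnorm (a - b).
  by rewrite ler_wpM2r ?rnorm_ge0// (le_trans (ler_norm K))// lerDl.
apply; rewrite -ltr_pdivlMl// [_^-1 * _]mulrC (le_lt_trans ab)//.
by have := divr_gt0 Re0 K1; lra.
Qed.

End LinearBounds.

Section BlinComplete.
Variables (R : realType) (E G : normedModType R[i]).
Hypothesis Gc : forall F : set_system G, ProperFilter F -> cauchy F -> cvg F.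

(** The limit is taken pointwise: evaluation at [x] is Lipschitz, so it preserves Cauchy filters.
    Completeness of [G] enters as a statement about filters so that the scalars [R[i]^o] are allowed
    as target. *)
Lemma blin_complete_of (F : set_system (blin E G)) :
  ProperFilter F -> cauchy F -> cvg F.
Proof.
move=> FF Fc.
have cF x : cvg ((fun f : blin E G => f x) @ F).
  apply: Gc; apply: (@cauchy_lipschitz _ _ _ _ (rnorm x)) => // f g.
  by rewrite mulrC; exact: (blin_rnorm_ge (f - g)).
pose h x : G := lim ((fun f : blin E G => f x) @ F).
have hP x (e : R) : 0 < e -> \forall f \near F, rnorm (h x - (f : blin E G) x) <= e.
  move=> e0; have e0' : 0 < e%:C by rewrite ltcR.
  move/cvgrPdist_le : (cF x) => /(_ _ e0'); apply: filterS => f.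
  by rewrite rnormE lecR.
have [a Fa] := cauchy_rnorm FF Fc ltr01.
have hlin : linear h.
  move=> c x y; apply: rnorm_le_eq => e e0.
  have c1 : 0 < rnorm c + 1 by rewrite ltr_wpDl ?rnorm_ge0.
  have e1 : 0 < e / 3 / (rnorm c + 1) by rewrite !divr_gt0.
  have e3 : 0 < e / 3 by rewrite divr_gt0.
  have [f [[f1 f2] f3]] :=
    filter_ex (filterI (filterI (hP (c *: x + y) _ e3) (hP x _ e1)) (hP y _ e3)).
  rewrite (_ : _ - _ = (h (c *: x + y) - f (c *: x + y)) +
     (- (c *: (h x - f x)) - (h y - f y))); last first.
    by rewrite (linearP f) scalerBr !opprB [X in _ = _ + X]addrACA -opprD addrA subrK.
  rewrite (le_trans (rnormD _ _))// (_ : e = e / 3 + (e / 3 + e / 3)); last lra.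
  rewrite lerD// (le_trans (rnormD _ _))// !rnormN lerD// rnormZ.
  rewrite (@le_trans _ _ ((rnorm c + 1) * rnorm (h x - f x)))//.
    by rewrite ler_wpM2r ?rnorm_ge0// lerDl.
  by rewrite -ler_pdivlMl// mulrC.
(* The tolerance at [x] is [rnorm x] itself, which contributes the first 1; the operators within 1
   of [a] contribute 1 + [rnorm a]. *)
have hb x : rnorm (h x) <= (2 + rnorm a) * rnorm x.
  have [x0|x0] := eqVneq (rnorm x) 0.
    by rewrite x0 mulr0 (rnorm0_eq0 x0) -(scale0r 0) -[_ *: _]addr0 hlin scale0r
      add0r (_ : h 0 = 0) ?rnorm0//; have := hlin (-1) 0 0;
      rewrite scaler0 addr0 scaleN1r addNr.
  have xp : 0 < rnorm x by rewrite lt_def x0 rnorm_ge0.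
  have [f [f1 f2]] := filter_ex (filterI (hP x _ xp) Fa).
  rewrite -(subrK (f x) (h x)) (le_trans (rnormD _ _))//.
  have f3 : rnorm (f x) <= (1 + rnorm a) * rnorm x.
    rewrite (le_trans (blin_rnorm_ge f x))// ler_wpM2r ?rnorm_ge0//.
    rewrite -(subrK a f) (le_trans (rnormD _ _))// lerD2r//.
    by rewrite rnormB.
  by move: f1 f3; lra.
apply/cvg_ex; exists (Blin (blin_of_subproof hlin hb)); apply: cvg_rnorm => e e0.
have [b Fb] := cauchy_rnorm FF Fc (divr_gt0 e0 (ltr0n _ 4)).
apply: filterS (Fb) => f bf; apply: blin_opn_le => [|x]; first exact: ltW.
have [x0|x0] := eqVneq (rnorm x) 0.
  by apply: le_trans (blin_rnorm_ge _ x) _; rewrite x0 !mulr0.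
have xp : 0 < rnorm x by rewrite lt_def x0 rnorm_ge0.
have e4 : 0 < e / 4 * rnorm x by rewrite mulr_gt0// divr_gt0.
(* [g] may depend on [x]: it is close to the limit at this point and within e / 4 of [b], hence
   within e / 2 of [f] in norm. The resulting bound is uniform in [x]. *)
have [g [g1 g2]] := filter_ex (filterI (hP x _ e4) Fb).
have gf : rnorm (g x - f x) <= (e / 4 + e / 4) * rnorm x.
  apply: le_trans (blin_rnorm_ge (g - f) x) _; rewrite ler_wpM2r ?rnorm_ge0//.
  by rewrite (le_trans (ler_rnormB g b f))// lerD// rnormB.
have := ler_rnormB (h x) (g x) (f x); rewrite /=.
by move: g1 gf; lra.
Qed.

End BlinComplete.

HB.instance Definition _ (R : realType) (E : normedModType R[i])
    (G : completeNormedModType R[i]) :=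
  Uniform_isComplete.Build (blin E G)
    (@blin_complete_of R E G (fun F FF Fc => @cauchy_cvg G F FF Fc)).

(* The regular module R[i]^o is not registered as a complete space: its
   instance would clash with the one of R^o. *)
Definition cdual (R : realType) (E : normedModType R[i]) : Type := dual E.

HB.instance Definition _ (R : realType) (E : normedModType R[i]) :=
  NormedModule.on (cdual E).
HB.instance Definition _ (R : realType) (E : normedModType R[i]) :=
  Uniform_isComplete.Build (cdual E)
    (@blin_complete_of R E R[i]^o (@complex_complete R)).

Lemma kappa_subproof (R : realType) (E : normedModType R[i]) :
  @kappa R E \in @blin_pred R E (dual (dual E)).
Proof.
apply: (@blin_of_subproof _ _ _ _ 1) => [c a b|a].
  by apply/val_inj/funext => f; exact: (linearP f).
rewrite mul1r; apply: blin_opn_le => [|f]; first exact: rnorm_ge0.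
by rewrite mulrC; exact: (blin_rnorm_ge f a).
Qed.

Definition kappa_blin (R : realType) (E : normedModType R[i]) :
  blin E (dual (dual E)) := Blin (kappa_subproof E).

(** * The space l^1 and its universal property *)

Section L1Theory.
Variable R : realType.

Local Notation l1 := (l1 R).
Local Notation psum a := (series (fun n => rnorm (a n))).

Lemma l1_scaleE (c : R[i]) (a : l1) n : (c *: a) n = c * a n.
Proof. by []. Qed.

Lemma l1_subE (a b : l1) n : (a - b) n = a n - b n.
Proof. by []. Qed.

Lemma l1_deltaE j n : l1_delta R j n = (n == j)%:R.
Proof. by []. Qed.

Definition l1_coord (n : nat) (a : l1) : R[i] := a n.

Lemma l1_coord_linear n : linear (l1_coord n : l1 -> R[i]^o).
Proof. by []. Qed.

HB.instance Definition _ n :=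
  GRing.isLinear.Build R[i] l1 R[i]^o *:%R (l1_coord n) (@l1_coord_linear n).

Lemma l1_sum_coord (I : Type) (s : seq I) (P : pred I) (f : I -> l1) n :
  (\sum_(i <- s | P i) f i) n = \sum_(i <- s | P i) f i n.
Proof. exact: (raddf_sum (l1_coord n : {linear l1 -> R[i]^o})). Qed.

Lemma psum_cvg (a : l1) : psum a n @[n --> \oo] --> rnorm a.
Proof. by have /asboolP := l1P a. Qed.

Lemma l1_rnorm_le (a : l1) K : (forall n, psum a n <= K) -> rnorm a <= K.
Proof. exact: psum_lim_le. Qed.

Lemma psum_diff (a : nat -> R[i]) m n : (m <= n)%N ->
  psum a n - psum a m = \sum_(m <= i < n) rnorm (a i).
Proof. by move=> mn; rewrite /series/= (big_cat_nat (leq0n m) mn)/= addrAC subrr add0r. Qed.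

Definition l1_trunc (n : nat) (a : l1) : l1 := \sum_(i < n) a i *: l1_delta R i.

Lemma l1_truncE n a k : l1_trunc n a k = if (k < n)%N then a k else 0.
Proof.
rewrite l1_sum_coord; case: ltnP => kn.
  rewrite (bigD1 (Ordinal kn))// big1 => [|i ik].
    by rewrite l1_scaleE l1_deltaE /= eqxx mulr1 addr0.
  rewrite l1_scaleE l1_deltaE (_ : (k == i :> nat) = false) ?mulr0//.
  by apply: contraNF ik => /eqP ki; apply/eqP/val_inj.
rewrite big1// => i _; rewrite l1_scaleE l1_deltaE gtn_eqF ?mulr0//.
exact: leq_trans (ltn_ord i) kn.
Qed.

Lemma l1_trunc_tail n (a : l1) : rnorm (a - l1_trunc n a) <= rnorm a - psum a n.
Proof.
have E i : rnorm ((a - l1_trunc n a : l1) i) = if (i < n)%N then 0 else rnorm (a i).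
  by rewrite l1_subE l1_truncE; case: ifP; rewrite ?subr0// subrr rnorm0.
apply: l1_rnorm_le => N.
(* Partial sums of norms only grow, so [N] is enlarged to at least [n]; both sides then become sums
   over one range starting at [n]. *)
have le : psum (a - l1_trunc n a : l1) N <= psum (a - l1_trunc n a : l1) (maxn n N).
  exact/psum_nd/leq_maxr.
apply: le_trans le _.
have z : psum (a - l1_trunc n a : l1) n = 0.
  rewrite /series/= big_nat_cond big1// => i /andP[/andP[_ i_n] _].
  by rewrite [LHS]E i_n.
rewrite -[leLHS]subr0 -z psum_diff ?leq_maxl//.
rewrite (@le_trans _ _ (psum a (maxn n N) - psum a n))//; last first.
  by rewrite lerD2r l1_psum_le.
rewrite psum_diff ?leq_maxl// big_nat_cond [leRHS]big_nat_cond.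
apply: ler_sum => i /andP[/andP[ni _] _].
by rewrite [leLHS]E ltnNge ni.
Qed.

Lemma l1_trunc_near (a : l1) (e : R) : 0 < e ->
  exists n, rnorm (a - l1_trunc n a) <= e.
Proof.
move=> e0; have /cvgrPdist_le/(_ _ e0)[n _ /(_ n (leqnn n))/= h] := @psum_cvg a.
exists n; rewrite (le_trans (l1_trunc_tail n a))// (le_trans _ h)//.
exact: ler_norm.
Qed.

(** Truncations are dense and [f - g] kills them. Many later identities, also bilinear ones, are
    reduced to basis vectors in this way. *)
Lemma l1_ext (V : normedModType R[i]) (f g : blin l1 V) :
  (forall j, f (l1_delta R j) = g (l1_delta R j)) -> f = g.
Proof.
move=> fg; apply/val_inj/funext => a; apply: rnorm_le_eq => e e0 /=.
have [K K0 hK] := blin_pos_bound (f - g).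
have [n an] := l1_trunc_near a (divr_gt0 e0 K0).
have E j : (f - g : blin l1 V) (l1_delta R j) = 0.
  by transitivity (f (l1_delta R j) - g (l1_delta R j)); rewrite // fg subrr.
have -> : f a - g a = (f - g : blin l1 V) (a - l1_trunc n a).
  rewrite linearB -[LHS]subr0; congr (_ - _); symmetry.
  rewrite linear_sum big1// => i _.
  by apply: etrans (linearZ_LR _ _ _) _; exact: etrans (congr1 _ (E i)) (scaler0 _ _).
by rewrite (le_trans (hK _))// -ler_pdivlMl// mulrC.
Qed.

Lemma l1_delta_rnorm j : rnorm (l1_delta R j) <= 1.
Proof.
apply: l1_rnorm_le => n; have [jn|nj] := ltnP j n; last first.
  rewrite /series/= big_nat_cond big1// => i /andP[/andP[_ ij] _].
  by rewrite ltn_eqF ?rnorm0//; exact: leq_trans nj.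
rewrite /series/= (bigD1_seq j)/= ?iota_uniq ?mem_index_iota//.
rewrite eqxx [rnorm _]rnorm_real normr1 big1 ?addr0// => i ij.
by rewrite (negPf ij) rnorm0.
Qed.

Lemma l1_delta_mul (a : l1) j : l1_delta R j ** a = a j *: l1_delta R j.
Proof.
apply/val_inj/funext => n; rewrite [RHS]l1_scaleE /=.
by have [->|nj] := eqVneq n j; rewrite ?mulr1 ?mulr0 ?mul1r ?mul0r.
Qed.

Lemma l1_mulC (a b : l1) : a ** b = b ** a.
Proof. by apply/val_inj/funext => n; exact: mulrC. Qed.

End L1Theory.

Section L1Lift.
Variables (R : realType) (G : completeNormedModType R[i]) (g : nat -> G) (K : R).
Hypothesis gK : forall n, rnorm (g n) <= K.

Local Notation l1 := (l1 R).
Local Notation psum a := (series (fun n => rnorm (a n))).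

Let K0 : 0 <= K. Proof. by apply: le_trans (gK 0); exact: rnorm_ge0. Qed.

Definition l1_psum_lift (a : l1) : G ^nat := series (fun n => a n *: g n).

Lemma l1_psum_lift_dist a m n : (m <= n)%N ->
  rnorm (l1_psum_lift a n - l1_psum_lift a m) <= K * (psum a n - psum a m).
Proof.
move=> mn; rewrite psum_diff// /l1_psum_lift /series/=.
rewrite (big_cat_nat (leq0n m) mn)/= addrAC subrr add0r (le_trans (rnorm_sum _ _ _))//.
rewrite mulr_sumr ler_sum// => i _; rewrite rnormZ mulrC.
by rewrite ler_wpM2r ?rnorm_ge0.
Qed.

Lemma l1_psum_lift_tail a m n : (m <= n)%N ->
  rnorm (l1_psum_lift a n - l1_psum_lift a m) <= K * (rnorm a - psum a m).
Proof.
move=> mn; rewrite (le_trans (l1_psum_lift_dist a mn))//.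
by rewrite ler_wpM2l// lerD2r l1_psum_le.
Qed.

Lemma l1_psum_lift_cvg a : cvgn (l1_psum_lift a).
Proof.
apply: cauchy_cvg; apply/cauchyP => e e0.
have eR : e = (complex.Re e)%:C by rewrite RRe_real// gtr0_real.
have Re0 : 0 < complex.Re e by move: e0; rewrite ltcE => /andP[].
have K1 : 0 < K + 1 by rewrite ltr_wpDl.
have /cvgrPdist_lt/(_ _ (divr_gt0 Re0 K1))[m _ /(_ m (leqnn m))/= h] := @psum_cvg R a.
exists (l1_psum_lift a m); exists m => // n /= mn.
rewrite eR; apply/rnorm_lt_ball; rewrite rnormB.
apply: le_lt_trans (l1_psum_lift_tail a mn) _.
have /(le_lt_trans _) := h; move=> /(_ _ (ler_norm _)).
rewrite ltr_pdivlMr// mulrC; apply: le_lt_trans.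
by rewrite ler_wpM2r ?lerDl// subr_ge0 l1_psum_le.
Qed.

Definition l1_lift_fun (a : l1) : G := limn (l1_psum_lift a).

(** The Cauchy estimate of the partial sums, passed to the limit; at [m = 0] it becomes the bound of
    the lift with the same constant [K]. *)
Lemma l1_lift_tail a m :
  rnorm (l1_lift_fun a - l1_psum_lift a m) <= K * (rnorm a - psum a m).
Proof.
apply/ler_addgt0Pr => e e0; have e0' : 0 < e%:C by rewrite ltcR.
have /cvgrPdist_le/(_ _ e0')[N _ /(_ (maxn N m))/=] := @l1_psum_lift_cvg a.
rewrite leq_maxl => /(_ isT); rewrite -/(l1_lift_fun a) rnormE lecR => h.
rewrite (le_trans (ler_rnormB _ (l1_psum_lift a (maxn N m)) _))// addrC.
by rewrite lerD// l1_psum_lift_tail// leq_maxr.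
Qed.

Lemma l1_lift_linear : linear l1_lift_fun.
Proof.
move=> c a b; apply/cvg_lim => //.
rewrite (_ : l1_psum_lift _ = (c *: l1_psum_lift a) \+ l1_psum_lift b).
  by apply: cvgD; [apply: cvgZr|]; exact: l1_psum_lift_cvg.
apply/funext => n; transitivity (c *: (\sum_(0 <= i < n) a i *: g i) +
  \sum_(0 <= i < n) b i *: g i); last by [].
rewrite scaler_sumr -big_split/=.
by apply: eq_bigr => i _; rewrite scalerA -scalerDl.
Qed.

Lemma l1_lift_bounded a : rnorm (l1_lift_fun a) <= K * rnorm a.
Proof.
by have := l1_lift_tail a 0; rewrite /l1_psum_lift /series/= !big_geq// !subr0.
Qed.

Definition l1_lift : blin l1 G := Blin (blin_of_subproof l1_lift_linear l1_lift_bounded).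

Lemma l1_lift_delta j : l1_lift (l1_delta R j) = g j.
Proof.
apply/cvg_lim => //; apply: cvg_rnorm => e e0; exists j.+1 => // n /= jn.
rewrite (_ : l1_psum_lift _ _ = g j) ?subrr ?rnorm0 ?(ltW e0)//.
rewrite /l1_psum_lift /series/= (bigD1_seq j)/= ?iota_uniq ?mem_index_iota//.
rewrite eqxx scale1r big1 ?addr0// => i ij.
by rewrite (negPf ij) scale0r.
Qed.

Lemma l1_lift_rnorm : rnorm l1_lift <= K.
Proof. by apply: blin_opn_le => // a; exact: l1_lift_bounded. Qed.

End L1Lift.

(** * Algebras isomorphic to l^1: commutativity and semisimplicity *)

(** Both maps are bounded without any condition of isometry, because [phi] is controlled only up to
    the constants 3 and 1/pi. *)
Record l1_iso (R : realType) (B : banachAlgType R) := L1Iso {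
  iso_to : blin (l1 R) B ;
  iso_from : blin B (l1 R) ;
  iso_toK : cancel iso_to iso_from ;
  iso_fromK : cancel iso_from iso_to ;
  iso_toM : forall a b, iso_to (a ** b) = iso_to a ** iso_to b }.

Section L1IsoTheory.
Variables (R : realType) (B : banachAlgType R) (w : l1_iso B).

Local Notation psi := (iso_to w).
Local Notation chi := (iso_from w).

Lemma iso_fromM x y : chi (x ** y) = chi x ** chi y.
Proof. by rewrite -{1}(iso_fromK w x) -{1}(iso_fromK w y) -iso_toM iso_toK. Qed.

Lemma l1_iso_commutative (x y : B) : x ** y = y ** x.
Proof. by rewrite -(iso_fromK w x) -(iso_fromK w y) -!iso_toM l1_mulC. Qed.

Definition coord_ker (j : nat) : set B := [set x | chi x j = 0].

Lemma coord_ker_left_ideal j : left_ideal (coord_ker j).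
Proof.
rewrite /coord_ker; split => [|c x y /= xj yj|a x /= xj].
- by rewrite /= linear0.
- rewrite linearP; transitivity (c * chi x j + chi y j) => //.
  by rewrite xj yj mulr0 addr0.
- rewrite iso_fromM; transitivity (chi a j * chi x j) => //.
  by rewrite xj mulr0.
Qed.

Lemma coord_ker_maximal j : maximal_modular_left_ideal (coord_ker j).
Proof.
split; first exact: coord_ker_left_ideal.
- exists (psi (l1_delta R j)) => a; rewrite /coord_ker /= linearB /= iso_fromM iso_toK.
  transitivity (chi a j - chi a j * l1_delta R j j) => //.
  by rewrite l1_deltaE eqxx mulr1 subrr.
- move=> /seteqP[_ /(_ (psi (l1_delta R j)) I)]; rewrite /coord_ker /= iso_toK.
  by rewrite l1_deltaE eqxx => /eqP; rewrite oner_eq0.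
- move=> L [L0 Llin Lmul] sL; have [/seteqP<-|nL] := pselect (L `<=>` coord_ker j).
    by left.
  right; have [x Lx xj] : exists2 x, L x & chi x j != 0.
    apply/not_exists2P => h; apply: nL; split => // x Lx.
    by case: (h x) => // /negP; rewrite negbK => /eqP.
  apply/seteqP; split => // y _.
  (* The kernel has codimension one: subtracting the multiple of [x] with the same j-th coordinate
     moves [y] into it. *)
  rewrite -(subrK ((chi y j / chi x j) *: x) y) addrC; apply: Llin => //; apply: sL.
  rewrite /coord_ker /= linearB linearZ.
  transitivity (chi y j - chi y j / chi x j * chi x j) => //.
  by rewrite divfK// subrr.
Qed.

Lemma l1_iso_semisimple : semisimple B.
Proof.
apply/seteqP; split => [x xJ|_ -> L [[]]//].
rewrite /= -(iso_fromK w x) (_ : chi x = 0) ?linear0//.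
by apply/val_inj/funext => j; exact: (xJ _ (coord_ker_maximal j)).
Qed.

End L1IsoTheory.

(** * Single generation *)

Section SinglyGenerated.
Variables (R : realType).

Lemma bmul0r (A : banachAlgType R) (x : A) : 0 ** x = 0.
Proof. by apply: (addrI (0 ** x)); rewrite -bmulDl !addr0. Qed.

Lemma bmulr0 (A : banachAlgType R) (x : A) : x ** 0 = 0.
Proof. by apply: (addrI (x ** 0)); rewrite -bmulDr !addr0. Qed.

(* If d is an idempotent orthogonal to z, then (d + z)^n = d + z^n. *)
Lemma closed_subalg_idempotent (A : banachAlgType R) (S : closedSubalg A) (d z : A) :
  d ** d = d -> d ** z = 0 -> z ** d = 0 -> rnorm z <= 2^-1 -> csa_set S (d + z) -> csa_set S d.
Proof.
move=> dd dz zd z2 Sdz.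
pose pw n := iter n (bmul z) z.
have dpw n : d ** pw n = 0.
  by case: n => [//|n]; rewrite /pw iterS bmulA dz bmul0r.
have Spw n : csa_set S (d + pw n).
  elim: n => [//|n IH]; rewrite (_ : d + _ = (d + z) ** (d + pw n)).
    exact: csaM.
  by rewrite bmulDl !bmulDr dd dpw zd addr0 add0r.
have npw n : rnorm (pw n) <= 2^-1 ^+ n.+1.
  elim: n => [//|n IH]; rewrite /pw iterS -/(pw n) exprS.
  by rewrite (le_trans (rnorm_bmul _ _))// ler_pM// rnorm_ge0.
apply: csa_closed; apply/closure_rnormP => e e0.
have [n ne] : exists n, 2^-1 ^+ n.+1 <= e.
  have h2 : `|2^-1 : R| < 1 by rewrite ger0_norm; lra.
  have /cvgrPdist_le/(_ _ e0)[n _ /(_ n (leqnn n))/=] := cvg_geometric 1 h2.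
  rewrite mul1r sub0r normrN => h; exists n.
  rewrite (le_trans _ h)// (le_trans _ (ler_norm _))// exprS.
  by rewrite ler_piMl ?exprn_ge0//; lra.
exists (d + pw n) => //.
by rewrite opprD addrA subrr sub0r rnormN (le_trans (npw n)).
Qed.

(** The ratio 1/3 is such that the tail after k, of norm at most 3/2 * 3^-(k+1), has norm at most
    1/2 once divided by 3^-k: the threshold in [closed_subalg_idempotent]. *)
Definition geo_seq (k n : nat) : R[i] := if (k <= n)%N then (3^-1 ^+ n)%:C else 0.

Local Notation psum a := (series (fun n => rnorm (a n))).

(** The second summand is the mass still to come. Carrying it along closes the induction, because
    3^-n + 3/2 * 3^-(n+1) = 3/2 * 3^-n. *)
Lemma geo_seq_psum k n : psum (geo_seq k) n + (if (k <= n)%N then 3 / 2 * 3^-1 ^+ n else 0)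
  <= (if (k <= n)%N then 3 / 2 * 3^-1 ^+ k else 0).
Proof.
elim: n => [|n IH].
  by rewrite /series/= big_geq// leqn0; case: eqP => [->|_]; rewrite add0r.
have -> : psum (geo_seq k) n.+1 = psum (geo_seq k) n + rnorm (geo_seq k n).
  by rewrite /series/= big_nat_recr//=.
have p0 : 0 <= 3^-1 ^+ n :> R by rewrite exprn_ge0// invr_ge0.
rewrite {2}/geo_seq.
have r3 : rnorm (3^-1 ^+ n)%:C = 3^-1 ^+ n :> R by rewrite rnorm_real ger0_norm.
move: IH; have [kn|kn|->] := ltngtP k n.+1.
- by rewrite -ltnS kn r3 exprS; lra.
- by rewrite leqNgt (ltn_trans (ltnSn n) kn)/= rnorm0 !addr0.
- by rewrite ltnn rnorm0; lra.
Qed.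

Lemma geo_seq_psum_le k n : psum (geo_seq k) n <= 3 / 2 * 3^-1 ^+ k.
Proof.
have c0 m : 0 <= 3 / 2 * 3^-1 ^+ m :> R by rewrite !mulr_ge0 ?exprn_ge0 ?invr_ge0.
have := geo_seq_psum k n; case: ifP => _ h.
  by rewrite (le_trans _ h)// lerDl.
by rewrite (le_trans _ (c0 k))// (le_trans _ h)// addr0.
Qed.

Definition geo (k : nat) : l1 R := L1 (l1_predP (geo_seq_psum_le k)).

Lemma geo_rnorm k : rnorm (geo k) <= 3 / 2 * 3^-1 ^+ k.
Proof. exact/l1_rnorm_le/geo_seq_psum_le. Qed.

Lemma geoS k : geo k = (3^-1 ^+ k)%:C *: l1_delta R k + geo k.+1.
Proof.
apply/val_inj/funext => n; transitivity ((3^-1 ^+ k)%:C * l1_delta R k n + geo k.+1 n).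
  rewrite l1_deltaE /= /geo_seq; case: (ltngtP k n) => [kn|kn|->].
  - by rewrite mulr0 add0r.
  - by rewrite mulr0 add0r.
  - by rewrite mulr1 addr0.
by [].
Qed.

(** Rescaled by 3^k, [geo k] is the idempotent delta_k plus a small tail orthogonal to it, so
    delta_k lies in [S]; removing it leaves [geo k.+1], and the argument repeats. *)
Lemma geo_delta (S : closedSubalg (l1 R)) k : csa_set S (geo 0) ->
  csa_set S (geo k) /\ forall j, (j < k)%N -> csa_set S (l1_delta R j).
Proof.
move=> S0; elim: k => [//|k [Sk Sj]].
have p3 : (3^-1 ^+ k)%:C != 0 :> R[i].
  by rewrite (inj_eq (@complexI _)) expf_neq0// invr_eq0 pnatr_eq0.
have Sd : csa_set S (l1_delta R k).
  apply: (@closed_subalg_idempotent _ _ _ ((3^-1 ^+ k)%:C^-1 *: geo k.+1)).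
  - by rewrite l1_delta_mul l1_deltaE eqxx scale1r.
  - rewrite l1_delta_mul (_ : l1_seq _ k = 0) ?scale0r//.
    by rewrite l1_scaleE /= /geo_seq ltnn mulr0.
  - rewrite l1_mulC l1_delta_mul (_ : l1_seq _ k = 0) ?scale0r//.
    by rewrite l1_scaleE /= /geo_seq ltnn mulr0.
  - rewrite rnormZ (_ : _^-1 = ((3^-1 ^+ k)^-1)%:C) ?rnorm_real; last first.
      by rewrite fmorphV.
    rewrite ger0_norm ?invr_ge0 ?exprn_ge0 ?invr_ge0//.
    rewrite ler_pdivrMl ?exprn_gt0 ?invr_gt0// (le_trans (geo_rnorm _))// exprS.
    by lra.
  - rewrite (_ : _ + _ = (3^-1 ^+ k)%:C^-1 *: geo k + 0).
      by apply: csaP => //; exact: csa0.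
    by rewrite addr0 [in RHS]geoS scalerDr scalerA mulVf// scale1r.
split=> [|j]; last by rewrite ltnS leq_eqVlt => /predU1P[->//|/Sj].
rewrite (_ : geo k.+1 = (- (3^-1 ^+ k)%:C) *: l1_delta R k + geo k).
  exact: csaP.
by rewrite [in RHS]geoS addrA -scalerDl addNr scale0r add0r.
Qed.

Lemma l1_subalg_geo (S : closedSubalg (l1 R)) : csa_set S (geo 0) -> forall a, csa_set S a.
Proof.
move=> S0 a; apply: csa_closed; apply/closure_rnormP => e e0.
have [n an] := l1_trunc_near a e0; exists (l1_trunc n a) => //.
rewrite /l1_trunc; elim/big_ind : _ => [|x y Sx Sy|i _]; first exact: csa0.
  by rewrite -[x]scale1r; exact: csaP.
rewrite -[X in csa_set S X]addr0; apply: csaP; last exact: csa0.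
by have [_] := geo_delta n S0; apply.
Qed.

Lemma l1_iso_singly_generated (B : banachAlgType R) (w : l1_iso B) :
  singly_generated B.
Proof.
exists (iso_to w (geo 0)); apply/seteqP; split => // x _ S /= Sb.
(* The preimage of a closed subalgebra of [B] is one of l^1, which moves the question to [geo 0]. *)
pose S' := [set a : l1 R | csa_set S (iso_to w a)].
have S'c : closed S'.
  apply: closed_rnorm => a h; apply: csa_closed; apply/closure_rnormP => e e0.
  have [K K0 hK] := blin_pos_bound (iso_to w).
  have [b Sb' ab] := h _ (divr_gt0 e0 K0); exists (iso_to w b) => //.
  rewrite -linearB (le_trans (hK _))// -ler_pdivlMl// mulrC.
  exact: ab.
have S'0 : S' 0 by rewrite /S' /= linear0; exact: csa0.
have S'P (c : R[i]) a b : S' a -> S' b -> S' (c *: a + b).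
  by rewrite /S' /= linearP; exact: csaP.
have S'M a b : S' a -> S' b -> S' (a ** b).
  by rewrite /S' /= iso_toM; exact: csaM.
rewrite -(iso_fromK w x).
exact: (@l1_subalg_geo (ClosedSubalg S'0 S'P S'M S'c) Sb (iso_from w x)).
Qed.

End SinglyGenerated.

(** * Failure of amenability *)

Section NotAmenable.
Variables (R : realType) (B : banachAlgType R) (w : l1_iso B).

Local Notation psi := (iso_to w).
Local Notation chi := (iso_from w).

Definition rmul_dual (a : B) : blin (cdual B) (cdual B) := adjoint (lmul a).

Lemma rmul_dual_subproof : rmul_dual \in @blin_pred R B (blin (cdual B) (cdual B)).
Proof.
apply: (@blin_of_subproof _ _ _ _ 1) => [c a b|a].
  apply/val_inj/funext => f; apply/val_inj/funext => x.
  by transitivity (f ((c *: a + b) ** x)) => //; rewrite bmulDl bmulZl linearP.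
rewrite mul1r; apply: blin_opn_le => [|f]; first exact: rnorm_ge0.
apply: blin_opn_le => [|x]; first by rewrite mulr_ge0 ?rnorm_ge0.
apply: (le_trans (blin_rnorm_ge (f : dual B) (a ** x))).
rewrite mulrC -mulrA [rnorm f * rnorm x]mulrC mulrA ler_wpM2r ?rnorm_ge0//.
exact: rnorm_bmul.
Qed.

(* The dual of B, with (x . a) b = x (a b) and a . x = 0. *)
Definition dual_bimodule : banachBimodule B.
Proof.
apply: (@BanachBimodule R B (cdual B) 0 (Blin rmul_dual_subproof)).
- by move=> a b x; rewrite linear0.
- move=> a b x; apply/val_inj/funext => y.
  by transitivity (x (a ** b ** y)); rewrite // -bmulA.
- by move=> a b x; rewrite linear0.
Defined.

(** Since the left action on X is 0, so is the right action on X', and the Leibniz rule shrinks to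
    compatibility of [kappa] with the remaining action. *)
Lemma kappa_derivation : @derivation R B dual_bimodule (kappa_blin B).
Proof.
move=> a b; apply/val_inj/funext => f.
transitivity (f (a ** b) + kappa a (0 : dual B)) => //.
by rewrite (linear0 (kappa a)) addr0.
Qed.

Lemma coord_sum_linear (n : nat) :
  linear (fun b : B => \sum_(i < n) chi b i : R[i]^o).
Proof.
move=> c x y; rewrite linearP scaler_sumr -big_split/=.
by apply: eq_bigr => i _.
Qed.

Lemma coord_sum_bounded (n : nat) (b : B) :
  rnorm (\sum_(i < n) chi b i : R[i]^o) <= rnorm chi * rnorm b.
Proof.
apply: le_trans (blin_rnorm_ge chi b).
rewrite (le_trans (rnorm_sum _ _ _))// (le_trans _ (l1_psum_le _ n))//.
by rewrite /series/= big_mkord.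
Qed.

Definition coord_sum (n : nat) : dual B :=
  Blin (blin_of_subproof (coord_sum_linear n) (coord_sum_bounded n)).

Lemma coord_sum_rnorm n : rnorm (coord_sum n) <= rnorm chi.
Proof. by apply: blin_opn_le; [exact: rnorm_ge0|exact: coord_sum_bounded]. Qed.

Definition unit_sum (n : nat) : l1 R := \sum_(i < n) l1_delta R i.

Lemma unit_sumE n i : (i < n)%N -> unit_sum n i = 1.
Proof.
move=> ni; rewrite /unit_sum l1_sum_coord (bigD1 (Ordinal ni))//= eqxx.
rewrite big1 ?addr0// => j ji; case: eqP => // ij.
by case/eqP : ji; exact/val_inj/esym.
Qed.

(** [coord_sum n] sees only the coordinates on which [unit_sum n] acts as an identity. Its norm
    stays bounded in [n], in contrast with its value n at [unit_sum n]. *)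
Lemma rmul_coord_sum n : rmul_dual (psi (unit_sum n)) (coord_sum n) = coord_sum n.
Proof.
apply/val_inj/funext => b.
transitivity (\sum_(i < n) chi (psi (unit_sum n) ** b) i); first by [].
apply: eq_bigr => i _; rewrite iso_fromM iso_toK.
transitivity (unit_sum n i * chi b i); first by [].
by rewrite unit_sumE// mul1r.
Qed.

Lemma coord_sum_unit_sum n : coord_sum n (psi (unit_sum n)) = n%:R.
Proof.
transitivity (\sum_(i < n) chi (psi (unit_sum n)) i); first by [].
rewrite iso_toK (eq_bigr (fun=> 1)) ?sumr_const ?card_ord// => i _.
exact: unit_sumE.
Qed.

Lemma inner_derivationE (X : banachBimodule B) (D : blin B (dual X)) (F : dual X) :
  (forall a, D a = dual_lact a F - dual_ract a F) ->
  forall a x, D a x = F (bm_ract X a x) - F (bm_lact X a x).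
Proof. by move=> hF a x; rewrite hF. Qed.

Lemma dual_bimodule_lact a (s : dual_bimodule) : bm_lact dual_bimodule a s = 0.
Proof. by []. Qed.

(** The implementing functional [F] lives in the bidual of [B] and acts there like an identity, a
    weak form of a bounded approximate identity. *)
Lemma amenable_inner_kappa : amenable B ->
  exists F : dual dual_bimodule, forall a (s : dual_bimodule),
    (s : dual B) a = F (bm_ract dual_bimodule a s).
Proof.
move=> /(_ dual_bimodule _ kappa_derivation)[F hF]; exists F => a s.
have := inner_derivationE hF a s.
by rewrite dual_bimodule_lact (linear0 F) subr0.
Qed.

(* Evaluating at a = delta_0 + ... + delta_(n-1) and at the sum of the first n
   coordinates bounds n. *)
Lemma l1_iso_not_amenable : ~ amenable B.
Proof.
move=> /amenable_inner_kappa[F hF].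
have ract n : bm_ract dual_bimodule (psi (unit_sum n)) (coord_sum n) = coord_sum n.
  exact: rmul_coord_sum.
have nFc n : n%:R <= rnorm F * rnorm chi.
  have := hF (psi (unit_sum n)) (coord_sum n).
  rewrite ract coord_sum_unit_sum => nE.
  have := blin_rnorm_ge F (coord_sum n).
  rewrite -nE (_ : n%:R = n%:R%:C) ?rnorm_real ?normr_nat ?rmorph_nat// => /le_trans; apply.
  by rewrite ler_wpM2l ?rnorm_ge0//; exact: coord_sum_rnorm.
have := archi_boundP (mulr_ge0 (rnorm_ge0 F) (rnorm_ge0 chi)).
by rewrite ltNge nFc.
Qed.

End NotAmenable.

(** * The projective tensor product *)

Lemma nat_pairing_exists : exists hu : (nat * nat -> nat) * (nat -> nat * nat),
  cancel hu.1 hu.2 /\ cancel hu.2 hu.1.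
Proof.
have /card_set_bijP[h] := card_nat2; rewrite setTT_bijective => -[u hK uK].
by exists (h, u).
Qed.

Definition nat_pair : nat * nat -> nat := (sval (cid nat_pairing_exists)).1.
Definition nat_unpair : nat -> nat * nat := (sval (cid nat_pairing_exists)).2.

Lemma nat_pairK : cancel nat_pair nat_unpair.
Proof. exact: (svalP (cid nat_pairing_exists)).1. Qed.

Lemma nat_unpairK : cancel nat_unpair nat_pair.
Proof. exact: (svalP (cid nat_pairing_exists)).2. Qed.

Section Postcomposition.
Variables (R : realType) (E F G : normedModType R[i]) (g : blin F G).

Lemma postcomp_subproof :
  (fun f : blin E F => blin_comp g f) \in @blin_pred R (blin E F) (blin E G).
Proof.
apply: (@blin_of_subproof _ _ _ _ (rnorm g)) => [c f h|f].
  by apply/val_inj/funext => x; exact: linearP.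
exact: blin_comp_le.
Qed.

Definition postcomp : blin (blin E F) (blin E G) := Blin postcomp_subproof.

End Postcomposition.

Section L1Tensor.
Variable R : realType.

Lemma l1_tensor_row_le i j : rnorm (l1_delta R (nat_pair (i, j))) <= 1.
Proof. exact: l1_delta_rnorm. Qed.

Lemma l1_tensor_le i : rnorm (l1_lift (l1_tensor_row_le i)) <= 1.
Proof. exact: l1_lift_rnorm. Qed.

(* The tensor product l^1(N) x l^1(N) -> l^1(N x N), with N x N enumerated. *)
Definition l1_tensor : blin (l1 R) (blin (l1 R) (l1 R)) := l1_lift l1_tensor_le.

Lemma l1_tensor_delta i j :
  l1_tensor (l1_delta R i) (l1_delta R j) = l1_delta R (nat_pair (i, j)).
Proof. by rewrite /l1_tensor !l1_lift_delta. Qed.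

Lemma bilin_l1_ext (V : normedModType R[i]) (f g : blin (l1 R) (blin (l1 R) V)) :
  (forall i j, f (l1_delta R i) (l1_delta R j) = g (l1_delta R i) (l1_delta R j)) ->
  f = g.
Proof. by move=> fg; apply: l1_ext => i; apply: l1_ext => j. Qed.

End L1Tensor.

Section ProjectiveTensor.
Variables (R : realType) (B : banachAlgType R) (w : l1_iso B).

Local Notation psi := (iso_to w).
Local Notation chi := (iso_from w).

Definition bilin_coef (G : completeNormedModType R[i]) (f : blin B (blin B G))
  (n : nat) : G :=
  f (psi (l1_delta R (nat_unpair n).1)) (psi (l1_delta R (nat_unpair n).2)).

Lemma bilin_coef_le (G : completeNormedModType R[i]) (f : blin B (blin B G)) n :
  rnorm (bilin_coef f n) <= rnorm f * rnorm psi ^+ 2.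
Proof.
have pd j : rnorm (psi (l1_delta R j)) <= rnorm psi.
  by rewrite (le_trans (blin_rnorm_ge _ _))// ler_piMr ?rnorm_ge0// l1_delta_rnorm.
apply: (le_trans (blin_rnorm_ge _ _)); rewrite expr2 mulrA ler_pM ?rnorm_ge0//.
by apply: (le_trans (blin_rnorm_ge _ _)); rewrite ler_wpM2l ?rnorm_ge0.
Qed.

Definition bilin_lift (G : completeNormedModType R[i]) (f : blin B (blin B G)) :
  blin (l1 R) G := l1_lift (bilin_coef_le f).

Lemma bilin_lift_tensor (G : completeNormedModType R[i]) (f : blin B (blin B G)) x y :
  bilin_lift f (l1_tensor R (chi x) (chi y)) = f x y.
Proof.
pose f1 := blin_comp (precomp G psi) (blin_comp f psi).
pose f2 := blin_comp (postcomp _ (bilin_lift f)) (l1_tensor R).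
rewrite -{2}(iso_fromK w x) -{2}(iso_fromK w y).
have E : f1 = f2.
  apply: bilin_l1_ext => i j.
  transitivity (f (psi (l1_delta R i)) (psi (l1_delta R j))) => //.
  transitivity (bilin_lift f (l1_tensor R (l1_delta R i) (l1_delta R j))) => //.
  by rewrite l1_tensor_delta /bilin_lift l1_lift_delta /bilin_coef nat_pairK.
exact: esym (congr1 (fun h : blin (l1 R) (blin (l1 R) G) => h (chi x) (chi y)) E).
Qed.

Lemma bilin_lift_rnorm (G : completeNormedModType R[i]) (f : blin B (blin B G)) t :
  rnorm (bilin_lift f t) <= rnorm f * rnorm psi ^+ 2 * rnorm t.
Proof.
apply: (le_trans (blin_rnorm_ge _ _)); rewrite ler_wpM2r ?rnorm_ge0//.
exact: l1_lift_rnorm.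
Qed.

Lemma bilin_coefZ (G : completeNormedModType R[i]) (f : blin B (blin B G)) c n :
  bilin_coef (c *: f) n = c *: bilin_coef f n.
Proof. by rewrite /bilin_coef !blin_scaleE. Qed.

Lemma bilin_liftZ (G : completeNormedModType R[i]) (f : blin B (blin B G)) c t :
  bilin_lift (c *: f) t = c *: bilin_lift f t.
Proof.
suff -> : bilin_lift (c *: f) = c *: bilin_lift f by [].
apply: l1_ext => j; apply: etrans (l1_lift_delta _ _) _.
transitivity (c *: bilin_lift f (l1_delta R j)); last by reflexivity.
by rewrite /bilin_lift l1_lift_delta bilin_coefZ.
Qed.

(* The projective norm, written as the supremum of the norms of the images
   under the linearizations of all contractive bilinear maps; this makes the
   universal property hold with constant 1. *)
Definition proj_values (t : l1 R) : set R :=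
  [set r | exists (G : completeNormedModType R[i]) (f : blin B (blin B G)),
    rnorm f <= 1 /\ r = rnorm (bilin_lift f t)].

Definition proj_rnorm (t : l1 R) : R := sup (proj_values t).

Lemma proj_values0 t : proj_values t !=set0.
Proof.
by exists (rnorm (bilin_lift (0 : blin B (blin B (l1 R))) t)), (l1 R), 0; rewrite rnorm0.
Qed.

Lemma proj_values_ub t r : proj_values t r -> r <= rnorm psi ^+ 2 * rnorm t.
Proof.
move=> [G [f [f1 ->]]]; apply: (le_trans (bilin_lift_rnorm f t)).
by rewrite ler_wpM2r ?rnorm_ge0// ler_piMl ?exprn_ge0 ?rnorm_ge0.
Qed.

Lemma proj_rnorm_ge (G : completeNormedModType R[i]) (f : blin B (blin B G)) t :
  rnorm f <= 1 -> rnorm (bilin_lift f t) <= proj_rnorm t.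
Proof.
move=> f1; apply: ub_le_sup; last by exists G, f.
by exists (rnorm psi ^+ 2 * rnorm t) => r /proj_values_ub.
Qed.

Lemma proj_rnorm_le t K :
  (forall (G : completeNormedModType R[i]) (f : blin B (blin B G)),
     rnorm f <= 1 -> rnorm (bilin_lift f t) <= K) -> proj_rnorm t <= K.
Proof.
move=> h; apply: ge_sup; first exact: proj_values0.
by move=> _ [G [f [f1 ->]]]; exact: h.
Qed.

Lemma proj_rnorm_ge0 t : 0 <= proj_rnorm t.
Proof.
apply: le_trans (@proj_rnorm_ge (l1 R) 0 t _); last by rewrite rnorm0.
exact: rnorm_ge0.
Qed.

Lemma proj_rnorm_upper t : proj_rnorm t <= rnorm psi ^+ 2 * rnorm t.
Proof.
by apply: proj_rnorm_le => G f f1; apply: proj_values_ub; exists G, f.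
Qed.

(** By homogeneity [f] may be divided by its norm; it is then one of the contractions in the
    supremum. When the norm is 0 the cruder bound in the l^1 norm settles it. *)
Lemma bilin_lift_proj (G : completeNormedModType R[i]) (f : blin B (blin B G)) t :
  rnorm (bilin_lift f t) <= rnorm f * proj_rnorm t.
Proof.
have [f0|f0] := eqVneq (rnorm f) 0.
  by apply: (le_trans (bilin_lift_rnorm f t)); rewrite f0 !mul0r.
have fp : 0 < rnorm f by rewrite lt_def f0 rnorm_ge0.
have r1 : rnorm ((rnorm f)^-1)%:C = (rnorm f)^-1.
  by rewrite rnorm_real ger0_norm ?invr_ge0 ?rnorm_ge0.
rewrite -ler_pdivrMl// -r1 -rnormZ -bilin_liftZ; apply: proj_rnorm_ge.
by rewrite rnormZ r1 mulVf.
Qed.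

Definition l1_tensor_iso : blin B (blin B (l1 R)) :=
  blin_comp (precomp _ chi) (blin_comp (l1_tensor R) chi).

(** The tensor map is itself a bounded bilinear map, and its linearization is the identity; hence
    the projective norm dominates a multiple of the l^1 norm. *)
Lemma bilin_lift_iso t : bilin_lift l1_tensor_iso t = t.
Proof.
rewrite -[RHS](iso_toK w).
suff -> : bilin_lift l1_tensor_iso = blin_comp chi psi by [].
apply: l1_ext => n; rewrite l1_lift_delta /bilin_coef.
transitivity (l1_tensor R (chi (psi (l1_delta R (nat_unpair n).1)))
  (chi (psi (l1_delta R (nat_unpair n).2)))) => //.
rewrite [RHS](_ : _ = chi (psi (l1_delta R n)))// !iso_toK l1_tensor_delta.
by rewrite -surjective_pairing nat_unpairK.
Qed.

Lemma proj_rnorm_lower : exists2 K : R, 0 < K & forall t, rnorm t <= K * proj_rnorm t.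
Proof.
exists (rnorm l1_tensor_iso + 1) => [|t]; first by rewrite ltr_wpDl ?rnorm_ge0.
rewrite -{1}(bilin_lift_iso t); apply: (le_trans (bilin_lift_proj _ _)).
by rewrite ler_wpM2r ?proj_rnorm_ge0// lerDl.
Qed.

End ProjectiveTensor.

(* l^1(N x N) with the projective norm of B x B. *)
Definition proj_space (R : realType) (B : banachAlgType R) (w : l1_iso B) : Type :=
  l1 R.

Section ProjectiveSpace.
Variables (R : realType) (B : banachAlgType R) (w : l1_iso B).

Local Notation psi := (iso_to w).
Local Notation chi := (iso_from w).
Local Notation P := (proj_space w).

HB.instance Definition _ := GRing.Lmodule.copy P (l1 R).

Definition proj_norm (t : P) : R[i] := (proj_rnorm w t)%:C.

Lemma proj_normD (s t : P) : proj_norm (s + t) <= proj_norm s + proj_norm t.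
Proof.
rewrite -rmorphD/= lecR; apply: proj_rnorm_le => G f f1.
rewrite (linearD (bilin_lift w f)) (le_trans (rnormD _ _))//.
by rewrite lerD// proj_rnorm_ge.
Qed.

Lemma proj_normZ (c : R[i]) (t : P) : proj_norm (c *: t) = `|c| * proj_norm t.
Proof.
have le d (s : P) : proj_rnorm w (d *: s) <= rnorm d * proj_rnorm w s.
  apply: proj_rnorm_le => G f f1.
  have -> : bilin_lift w f (d *: s) = d *: bilin_lift w f s by exact: linearZ_LR.
  rewrite rnormZ ler_wpM2l ?rnorm_ge0//.
  exact: proj_rnorm_ge.
rewrite /proj_norm rnormE -rmorphM; congr (_%:C); apply/eqP.
rewrite eq_le le andTb; have [->|c0] := eqVneq c 0.
  by rewrite rnorm0 mul0r proj_rnorm_ge0.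
have c0' : 0 < rnorm c.
  by rewrite lt_def rnorm_ge0 andbT; apply: contra c0 => /eqP/rnorm0_eq0->.
have cV : rnorm c^-1 = (rnorm c)^-1.
  apply: (mulfI (lt0r_neq0 c0')); rewrite -rnormM (mulfV c0) (mulfV (lt0r_neq0 c0')).

  by rewrite [rnorm 1]rnorm_real normr1.
by rewrite -ler_pdivlMl// -cV -{1}[t](scale1r t) -(mulVf c0) -scalerA le.
Qed.

Lemma proj_norm0_eq0 (t : P) : proj_norm t = 0 -> t = 0.
Proof.
move=> /complexI t0; have [K _ /(_ t)] := proj_rnorm_lower w.
rewrite t0 mulr0 => h; apply: (@rnorm0_eq0 _ (l1 R)).
by apply/eqP; rewrite eq_le h rnorm_ge0.
Qed.

HB.instance Definition _ :=
  Lmodule_isNormed.Build R[i] P proj_normD proj_normZ proj_norm0_eq0.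

Lemma proj_of_l1_linear : linear (id : l1 R -> P).
Proof. by []. Qed.

Definition proj_of_l1 : blin (l1 R) P :=
  Blin (blin_of_subproof proj_of_l1_linear (proj_rnorm_upper w)).

Lemma proj_complete (F : set_system P) : ProperFilter F -> cauchy F -> cvg F.
Proof.
move=> FF Fc; have [K K0 hK] := proj_rnorm_lower w.
have /cvg_ex[y Fy] : cvg ((id : P -> l1 R) @ F).
  apply: cauchy_cvg; apply: (@cauchy_lipschitz R P (l1 R) id K F _ FF Fc) => s t.
  exact: (hK (s - t)).
apply/cvg_ex; exists y; apply: cvg_rnorm => e e0.
have [L L0 hL] := blin_pos_bound proj_of_l1.
have e0' : 0 < (e / L)%:C by rewrite ltcR divr_gt0.
move/cvgrPdist_le : Fy => /(_ _ e0'); apply: filterS => t.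
rewrite rnormE lecR => h; apply: (le_trans (hL (y - t))).
by rewrite -ler_pdivlMl// mulrC.
Qed.

HB.instance Definition _ := Uniform_isComplete.Build P proj_complete.

Definition proj_map : blin B (blin B P) :=
  blin_comp (postcomp B proj_of_l1) (l1_tensor_iso w).

Lemma proj_map_norm x y : `|proj_map x y| <= `|x| * `|y|.
Proof.
rewrite !rnormE -rmorphM lecR; apply: proj_rnorm_le => G f f1.
rewrite (_ : bilin_lift w f _ = f x y); last exact: bilin_lift_tensor.
apply: (le_trans (blin_rnorm_ge _ _)); rewrite ler_wpM2r ?rnorm_ge0//.
by apply: (le_trans (blin_rnorm_ge _ _)); rewrite ler_piMl ?rnorm_ge0.
Qed.

Lemma proj_lift_linear (G : completeNormedModType R[i]) (f : blin B (blin B G)) :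
  linear (bilin_lift w f : P -> G).
Proof. exact: (linearP (bilin_lift w f)). Qed.

Definition proj_lift (G : completeNormedModType R[i]) (f : blin B (blin B G)) :
  blin P G := Blin (blin_of_subproof (proj_lift_linear f) (bilin_lift_proj w f)).

Lemma proj_liftE (G : completeNormedModType R[i]) (f : blin B (blin B G)) x y :
  proj_lift f (proj_map x y) = f x y.
Proof. exact: bilin_lift_tensor. Qed.

Lemma proj_lift_norm (G : completeNormedModType R[i]) (f : blin B (blin B G)) :
  `|proj_lift f| <= `|f|.
Proof.
rewrite !rnormE lecR; apply: blin_opn_le => [|t]; first exact: rnorm_ge0.
exact: bilin_lift_proj.
Qed.

(** Each basis vector is an elementary tensor, which is why a bounded map on P is determined by its
    values on elementary tensors. *)
Lemma proj_map_delta n :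
  proj_map (psi (l1_delta R (nat_unpair n).1)) (psi (l1_delta R (nat_unpair n).2)) =
  l1_delta R n.
Proof.
transitivity (l1_tensor R (chi (psi (l1_delta R (nat_unpair n).1)))
  (chi (psi (l1_delta R (nat_unpair n).2)))) => //.
by rewrite !iso_toK l1_tensor_delta -surjective_pairing nat_unpairK.
Qed.

Lemma proj_lift_uniq (G : completeNormedModType R[i]) (f : blin B (blin B G))
  (g : blin P G) : (forall x y, g (proj_map x y) = f x y) -> g = proj_lift f.
Proof.
move=> gf; apply/val_inj/funext => t.
suff E : blin_comp g proj_of_l1 = bilin_lift w f.
  exact: (congr1 (fun h : blin (l1 R) G => h t) E).
apply: l1_ext => n; rewrite l1_lift_delta /bilin_coef -gf.
by rewrite proj_map_delta.
Qed.

Definition l1_iso_projTensor : projTensor B B :=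
  ProjTensor proj_map_norm proj_liftE proj_lift_norm proj_lift_uniq.

End ProjectiveSpace.

(** * Biflatness *)

Section Biflat.
Variables (R : realType) (B : banachAlgType R) (w : l1_iso B).

Local Notation psi := (iso_to w).
Local Notation chi := (iso_from w).
Local Notation P := (l1_iso_projTensor w).

Lemma diag_delta_le n : rnorm (l1_delta R (nat_pair (n, n))) <= 1.
Proof. exact: l1_delta_rnorm. Qed.

Definition diag_splitting : blin B P :=
  blin_comp (proj_of_l1 w) (blin_comp (l1_lift diag_delta_le) chi).

Lemma diag_splitting_delta j : diag_splitting (psi (l1_delta R j)) =
  pt_map P (psi (l1_delta R j)) (psi (l1_delta R j)).
Proof.
transitivity (l1_lift diag_delta_le (chi (psi (l1_delta R j)))) => //.
rewrite iso_toK l1_lift_delta.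
transitivity (l1_tensor R (chi (psi (l1_delta R j))) (chi (psi (l1_delta R j)))) => //.
by rewrite iso_toK l1_tensor_delta.
Qed.

Lemma l1_iso_ext (V : normedModType R[i]) (f g : blin B V) :
  (forall j, f (psi (l1_delta R j)) = g (psi (l1_delta R j))) -> f = g.
Proof.
move=> fg; apply/val_inj/funext => x; rewrite /= -(iso_fromK w x).
have E : blin_comp f psi = blin_comp g psi by apply: l1_ext.
exact: (congr1 (fun h : blin (l1 R) V => h (chi x)) E).
Qed.

Lemma iso_mul_delta a j : a ** psi (l1_delta R j) = chi a j *: psi (l1_delta R j).
Proof.
rewrite -{1}(iso_fromK w a) -iso_toM l1_mulC l1_delta_mul.
exact: linearZ_LR.
Qed.

(** At b = delta_j both sides are a_j (delta_j (x) delta_j), because a delta_j = a_j delta_j. *)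
Lemma diag_splitting_lact a b : diag_splitting (a ** b) = pt_lact P a (diag_splitting b).
Proof.
suff E : blin_comp diag_splitting (lmul a) = blin_comp (pt_lact P a) diag_splitting.
  exact: (congr1 (fun h : blin B P => h b) E).
apply: l1_iso_ext => j.
transitivity (diag_splitting (a ** psi (l1_delta R j))); first by [].
transitivity (pt_lact P a (diag_splitting (psi (l1_delta R j)))); last by [].
rewrite diag_splitting_delta pt_liftE.
transitivity (pt_map P (a ** psi (l1_delta R j)) (psi (l1_delta R j))); last by [].
by rewrite iso_mul_delta !blinZ diag_splitting_delta.
Qed.

Lemma diag_splitting_ract a b : diag_splitting (a ** b) = pt_ract P b (diag_splitting a).
Proof.
suff E : blin_comp diag_splitting (rmul b) = blin_comp (pt_ract P b) diag_splitting.
  exact: (congr1 (fun h : blin B P => h a) E).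
apply: l1_iso_ext => j.
transitivity (diag_splitting (psi (l1_delta R j) ** b)); first by [].
transitivity (pt_ract P b (diag_splitting (psi (l1_delta R j)))); last by [].
rewrite diag_splitting_delta pt_liftE.
transitivity (pt_map P (psi (l1_delta R j)) (psi (l1_delta R j) ** b)); last by [].
rewrite (l1_iso_commutative w _ b) iso_mul_delta !blinZ.
by rewrite diag_splitting_delta.
Qed.

Lemma pt_pi_diag_splitting a : pt_pi P (diag_splitting a) = a.
Proof.
suff E : blin_comp (pt_pi P) diag_splitting = blin_comp psi chi.
  rewrite -[RHS](iso_fromK w); exact: (congr1 (fun h : blin B B => h a) E).
apply: l1_iso_ext => j.
transitivity (pt_pi P (diag_splitting (psi (l1_delta R j)))); first by [].
rewrite diag_splitting_delta pt_liftE.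
transitivity (psi (l1_delta R j) ** psi (l1_delta R j)); first by [].
rewrite iso_mul_delta iso_toK l1_deltaE eqxx scale1r.
exact: (congr1 psi (esym (iso_toK w _))).
Qed.

(** Second adjoints extend the original maps along the canonical embedding, so a splitting into P
    becomes one into its bidual. *)
Lemma l1_iso_biflat : biflat B.
Proof.
exists P, (blin_comp (kappa_blin P) diag_splitting); split => [a b|a b|a].
- apply/val_inj/funext => f.
  exact: (congr1 f (diag_splitting_lact a b)).
- apply/val_inj/funext => f.
  exact: (congr1 f (diag_splitting_ract a b)).
- apply/val_inj/funext => f.
  exact: (congr1 f (pt_pi_diag_splitting a)).
Qed.

End Biflat.

(** * Subset sums of complex numbers *)

Section SubsetSums.
Variable R : realType.

Lemma sin_le_id (x : R) : 0 <= x -> sin x <= x.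
Proof.
move=> x0; have [c _] := @MVT_segment R sin cos 0 x x0
  (fun y _ => is_derive_sin y)
  (continuous_subspaceT (@continuous_sin R)).
by rewrite sin0 !subr0 => ->; rewrite ler_piMl// cos_le1.
Qed.

Lemma le_cos_norm (u v : R) : `|u| <= v -> v <= pi -> cos v <= cos u.
Proof.
move=> uv vpi; rewrite -(cos_norm u); move: uv; rewrite le_eqVlt => /predU1P[->//|uv].
by apply/ltW; rewrite ltr_cos// in_itv/= ?normr_ge0 ?vpi ?(le_trans (ltW uv))// (le_trans _ (ltW uv)).
Qed.

(** The angle is acos (x / r) with the sign of y. Its lower bound makes [y] non-negative in
    [sum_cos_pos_ge]. *)
Lemma polar_form (z : R[i]) : exists2 t : R, - pi <= t &
  complex.Re z = rnorm z * cos t /\ complex.Im z = rnorm z * sin t.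
Proof.
case: z => x y; set r := rnorm _; have r0 : 0 <= r by exact: rnorm_ge0.
have rE : r ^+ 2 = x ^+ 2 + y ^+ 2.
  by rewrite /r /rnorm normc_def/= sqr_sqrtr// addr_ge0// sqr_ge0.
have [r00|r00] := eqVneq r 0.
  exists 0; first by rewrite oppr_le0 pi_ge0.
  rewrite r00 !mul0r; move/eqP : rE; rewrite r00 expr0n/= eq_sym paddr_eq0 ?sqr_ge0//.
  by rewrite !sqrf_eq0 => /andP[/eqP -> /eqP ->].
have rp : 0 < r by rewrite lt_def r00.
have xr : -1 <= x / r <= 1.
  rewrite -ler_norml normrM normfV (ger0_norm r0) ler_pdivrMr// mul1r.
  rewrite -(ger0_norm r0) -!sqrtr_sqr ler_sqrt ?sqr_ge0// rE lerDl sqr_ge0//.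
have cE : cos (acos (x / r)) = x / r by rewrite acosK// in_itv/= xr.
have sE : r * sin (acos (x / r)) = `|y|.
  rewrite sin_acos// -{1}(ger0_norm r0) -sqrtr_sqr -sqrtrM ?sqr_ge0//.
  rewrite mulrBr mulr1 expr_div_n [r ^+ 2 * _]mulrC divfK ?expf_neq0// rE.
  by rewrite addrAC subrr add0r sqrtr_sqr.
have [y0|y0] := leP 0 y.
  exists (acos (x / r)); first by rewrite (le_trans _ (acos_ge0 xr))// oppr_le0 pi_ge0.
  by rewrite sE cE mulrC divfK// ger0_norm.
exists (- acos (x / r)); first by rewrite lerN2 acos_lepi.
by rewrite cosN sinN cE mulrC divfK// mulrN sE ltr0_norm// opprK.
Qed.

(** The sum telescopes, since 2 sin (h/2) cos a = sin (a + h/2) - sin (a - h/2). *)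
Lemma sum_cos_progression (h t : R) (j m : nat) :
  2 * sin (h / 2) * (\sum_(j <= k < j + m) cos (k%:R * h - t)) =
  sin ((j + m)%:R * h - h / 2 - t) - sin (j%:R * h - h / 2 - t).
Proof.
elim: m => [|m IH]; first by rewrite addn0 big_geq// mulr0 subrr.
rewrite addnS big_nat_recr ?leq_addr//= mulrDr IH.
set k := (j + m)%N; set a := k%:R * h - t.
have -> : k.+1%:R * h - h / 2 - t = a + h / 2 by rewrite /a -natr1; field.
have -> : k%:R * h - h / 2 - t = a - h / 2 by rewrite /a; ring.
by rewrite (sinB a (h / 2)) (sinD a (h / 2)); ring.
Qed.

Lemma sum_periodic (f : nat -> R) (p j : nat) : (forall k, f (k + p)%N = f k) ->
  \sum_(0 <= k < p) f k = \sum_(j <= k < j + p) f k.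
Proof.
move=> fp; elim: j => [//|j ->]; case: p fp => [|p] fp; first by rewrite !addn0 !big_geq.
rewrite big_ltn ?addnS ?ltnS ?leq_addr// addSn [RHS]big_nat_recr ?ltnS ?leq_addr//=.
by rewrite addrC -addnS fp.
Qed.

(* A full period of cos^+ over 2 m equally spaced angles contains m consecutive
   angles lying within pi/2, up to half a step. *)
Lemma sum_cos_pos_ge (m : nat) (h t : R) : (0 < m)%N -> - pi <= t ->
  h = pi / m%:R ->
  cos (h / 2) <= sin (h / 2) * \sum_(0 <= k < m + m) Num.max 0 (cos (k%:R * h - t)).
Proof.
move=> m0 tpi hE.
have mR : 0 < m%:R :> R by rewrite ltr0n.
have hm : m%:R * h = pi by rewrite hE mulrC divfK// gt_eqF.
have h0 : 0 < h by rewrite hE divr_gt0// pi_gt0.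
have hpi : h <= pi by rewrite hE ler_piMr ?pi_ge0// invf_le1// ler1n.
have sh0 : 0 <= sin (h / 2) by apply: sin_ge0_pi; have := @pi_gt0 R; lra.
(* The angle 3 pi / 2 stands for - pi / 2, moved by a full turn so that the index is a natural
   number. From [j] on, the m angles k h - t lie, modulo 2 pi, between - pi / 2 and pi / 2. *)
pose y := (t + 3 / 2 * pi) / h.
have y0 : 0 <= y by rewrite divr_ge0 ?(ltW h0)//; have := @pi_gt0 R; lra.
have /andP[y1 y2] := truncn_itv y0.
pose j := (Num.truncn y).+1.
have jh1 : t + 3 / 2 * pi <= j%:R * h by rewrite -ler_pdivrMr// ltW.
have jh2 : j%:R * h <= t + 3 / 2 * pi + h.
  rewrite /j -natr1 mulrDl mul1r lerD2r -ler_pdivlMr//.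
rewrite (@sum_periodic _ _ j) => [|k]; last first.
  rewrite natrD mulrDl natrD [(m%:R + m%:R) * h]mulrDl hm.
  by rewrite addrAC -mulr2n cosD2pi.
rewrite addnA (@big_cat_nat _ _ _ (j + m)) ?leq_addr//= mulrDr.
apply: (@le_trans _ _ (sin (h / 2) * \sum_(j <= k < j + m) cos (k%:R * h - t))); last first.
  rewrite -[leLHS]addr0 lerD//; last by rewrite mulr_ge0// sumr_ge0// => k _; rewrite le_max lexx.
  by rewrite ler_wpM2l// ler_sum// => k _; rewrite le_max lexx orbT.
have := sum_cos_progression h t j m.
have -> : (j + m)%:R * h - h / 2 - t = (j%:R * h - h / 2 - t) + pi.
  by rewrite natrD mulrDl hm; ring.
rewrite sinDpi.
have -> : sin (j%:R * h - h / 2 - t) = - cos (j%:R * h - h / 2 - t - 3 / 2 * pi).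
  rewrite (_ : _ - 3 / 2 * pi = j%:R * h - h / 2 - t + pi / 2 - pi *+ 2); last first.
    by rewrite mulr2n; field.
  by rewrite -[in RHS]cosD2pi subrK cosDpihalf opprK.
(* By the choice of [j] the argument on the right lies between - h / 2 and h / 2. *)
have : cos (h / 2) <= cos (j%:R * h - h / 2 - t - 3 / 2 * pi).
  by apply: le_cos_norm; last lra; rewrite ler_norml; apply/andP; split; lra.
by rewrite -mulrA; lra.
Qed.

Lemma Re_rotate_le (z : R[i]) (s : R) :
  complex.Re z * cos s + complex.Im z * sin s <= rnorm z.
Proof.
have [t _ [-> ->]] := polar_form z.
by rewrite -!mulrA -mulrDr -cosB ler_piMr ?rnorm_ge0// cos_le1.
Qed.

Lemma subset_sum_cos (I : finType) (z : I -> R[i]) (M : R) (m : nat) : (0 < m)%N ->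
  (forall P : pred I, rnorm (\sum_(i | P i) z i) <= M) ->
  cos (pi / m%:R / 2) * \sum_i rnorm (z i) <= pi * M.
Proof.
move=> m0 hM; set h := pi / m%:R.
have mR : 0 < m%:R :> R by rewrite ltr0n.
have h0 : 0 < h by rewrite divr_gt0// pi_gt0.
have M0 : 0 <= M by apply: le_trans (hM xpred0); exact: rnorm_ge0.
pose f i (s : R) := complex.Re (z i) * cos s + complex.Im (z i) * sin s.
have fM s : \sum_i Num.max 0 (f i s) <= M.
  (* Over the indices with positive term, the sum of positive parts is the real part of one rotated
     subset sum. *)
  apply: le_trans (hM (fun i => 0 < f i s)).
  apply: le_trans (Re_rotate_le _ s); rewrite !raddf_sum !mulr_suml -big_split/=.
  rewrite (bigID (fun i => 0 < f i s))/= [X in _ + X]big1 ?addr0 => [|i]; last first.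
    by rewrite -leNgt => /max_idPl.
  by apply: ler_sum => i fi; rewrite (max_idPr (ltW fi)).
have sM : \sum_(0 <= k < m + m) \sum_i Num.max 0 (f i (k%:R * h)) <= M *+ (m + m).
  rewrite (le_trans (ler_sum _ (fun k _ => fM (k%:R * h))))//.
  by rewrite big_const_nat iter_addr_0 subn0.
have zi i : cos (h / 2) * rnorm (z i) <=
    sin (h / 2) * \sum_(0 <= k < m + m) Num.max 0 (f i (k%:R * h)).
  have [t tpi [zr zI]] := polar_form (z i).
  rewrite (eq_bigr (fun k => rnorm (z i) * Num.max 0 (cos (k%:R * h - t)))) => [|k _].
    rewrite -mulr_sumr mulrCA [leLHS]mulrC ler_wpM2l ?rnorm_ge0//.
    exact: sum_cos_pos_ge.
  rewrite maxr_pMr ?rnorm_ge0// mulr0 /f zr zI -!mulrA -mulrDr cosB.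
  by congr (Num.max 0 (_ * _)); ring.
rewrite mulr_sumr (le_trans (ler_sum _ (fun i _ => zi i)))// -mulr_sumr exchange_big/=.
have hpi : h <= pi by rewrite /h ler_piMr ?pi_ge0// invf_le1// ler1n.
have sh0 : 0 <= sin (h / 2) by apply: sin_ge0_pi; have := @pi_gt0 R; lra.
rewrite (le_trans (ler_wpM2l sh0 sM))//.
have h20 : 0 <= h / 2 by rewrite divr_ge0// ltW.
(* With 2 m angles and sin (h / 2) <= h / 2 the bound is m h M, that is pi M. *)
rewrite (@le_trans _ _ (h / 2 * M *+ (m + m)))//.
  by rewrite mulrnAr ler_wMn2r// ler_wpM2r// sin_le_id.
rewrite -mulr_natl natrD /h le_eqVlt; apply/orP; left; apply/eqP; field.
by rewrite gt_eqF.
Qed.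

Lemma subset_sum_bound (I : finType) (z : I -> R[i]) (M : R) :
  (forall P : pred I, rnorm (\sum_(i | P i) z i) <= M) ->
  \sum_i rnorm (z i) <= pi * M.
Proof.
move=> hM; set S := \sum_i _.
(* Refining the angles removes the loss cos (h / 2); [m.+1] keeps the number of angles positive. *)
have c1 : cos (pi / m.+1%:R / 2) * S @[m --> \oo] --> cos (0 : R) * S.
  apply: cvgM; last exact: cvg_cst.
  have cc : (cos : R -> R) s @[s --> (0 : R)] --> cos (0 : R) by exact: continuous_cos.
  apply: (cvg_comp _ _ _ cc).
  rewrite (_ : (fun m : nat => pi / m.+1%:R / 2) = (fun m => pi / 2 * harmonic m)).
    suff : (fun m => pi / 2 * harmonic m) @ \oo --> (pi / 2 : R) * 0 by rewrite mulr0.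
    by apply: cvgM; [exact: cvg_cst|exact: cvg_harmonic].
  by apply/funext => m; rewrite /harmonic /=; ring.
rewrite -[S]mul1r -cos0 -(cvg_lim _ c1)//; apply: limr_le.
  by apply/cvg_ex; exists (cos 0 * S).
by apply: nearW => m; exact: subset_sum_cos.
Qed.

End SubsetSums.

(** * The idempotents E_n *)

Lemma big_option_split (T : finType) (V : nmodType) (f : option T -> V) :
  \sum_p f p = f None + \sum_x f (Some x).
Proof.
rewrite (bigD1 None)//=; congr (_ + _).
rewrite (reindex_omap Some id) => [|[x|]//].
by apply: eq_bigl => x; rewrite eqxx.
Qed.

Section Idempotents.
Variable R : realType.

Definition vec_on (F : {fset nat}) (v : ext nat -> R[i]) : 'cV[R[i]]_#|extF F| :=
  \col_k v (extF_incl (enum_val k)).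

Lemma sum_extF (V : nmodType) (F : {fset nat}) (f : ext nat -> V) :
  \sum_(k < #|extF F|) f (extF_incl (enum_val k)) =
  f (ext_alpha _) + f (ext_omega _) + \sum_(s : F) f (ext_pt (val s)).
Proof.
rewrite -(big_enum_val (fun p : extF F => f (extF_incl p))).
rewrite (eq_bigl predT)// [LHS]big_option_split (big_option_split (fun p => f (omap _ (Some p)))).
by rewrite addrA.
Qed.

Lemma x_vec_alpha n : x_vec R n (ext_alpha _) = 1.
Proof. by rewrite /x_vec /basis_vec /= add0r addr0. Qed.

Lemma x_vec_omega n : x_vec R n (ext_omega _) = 1.
Proof. by rewrite /x_vec /basis_vec /= !addr0. Qed.

Lemma x_vec_pt n s : x_vec R n (ext_pt s) = (s == n)%:R.
Proof. by rewrite /x_vec /basis_vec /= !add0r. Qed.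

Lemma y_vec_alpha n : y_vec R n (ext_alpha _) = -1.
Proof. by rewrite /y_vec /basis_vec /= add0r addr0. Qed.

Lemma y_vec_omega n : y_vec R n (ext_omega _) = 1.
Proof. by rewrite /y_vec /basis_vec /= subr0 addr0. Qed.

Lemma y_vec_pt n s : y_vec R n (ext_pt s) = (s == n)%:R.
Proof. by rewrite /y_vec /basis_vec /= subrr add0r. Qed.

Lemma sum_pt_eq (V : nmodType) (F : {fset nat}) n (c : V) : n \in F ->
  \sum_(s : F) (if val s == n then c else 0) = c.
Proof.
move=> nF; rewrite (bigD1 [` nF]%fset)//= eqxx big1 ?addr0// => s sn.
by case: eqP => // sE; move/eqP : sn; case; exact: val_inj.
Qed.

Lemma l2n_x_vec (F : {fset nat}) n : n \in F -> l2n (vec_on F (x_vec R n)) = Num.sqrt 3.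
Proof.
move=> nF; rewrite /l2n; congr Num.sqrt.
under eq_bigr do rewrite mxE.
rewrite (sum_extF _ (fun p => rnorm (x_vec R n p) ^+ 2)).
rewrite x_vec_alpha x_vec_omega.
rewrite (eq_bigr (fun s : F => if val s == n then 1 else 0)) => [|s _].
  by rewrite sum_pt_eq// [rnorm _]rnorm_real normr1; ring.
by rewrite x_vec_pt; case: eqP => _; rewrite [rnorm _]rnorm_real ?normr1 ?normr0 ?expr1n ?expr0n.
Qed.

Lemma l2n_y_vec (F : {fset nat}) n : n \in F -> l2n (vec_on F (y_vec R n)) = Num.sqrt 3.
Proof.
move=> nF; rewrite /l2n; congr Num.sqrt.
under eq_bigr do rewrite mxE.
rewrite (sum_extF _ (fun p => rnorm (y_vec R n p) ^+ 2)).
rewrite y_vec_alpha y_vec_omega rnormN.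
rewrite (eq_bigr (fun s : F => if val s == n then 1 else 0)) => [|s _].
  by rewrite sum_pt_eq// [rnorm _]rnorm_real normr1; ring.
by rewrite y_vec_pt; case: eqP => _; rewrite [rnorm _]rnorm_real ?normr1 ?normr0 ?expr1n ?expr0n.
Qed.

(** The coordinates at alpha and omega contribute -1 and 1 and cancel; only the points of [F]
    remain. This gives both idempotence and orthogonality of the E_n. *)
Lemma cinner_y_x (F : {fset nat}) m n : n \in F ->
  cinner (vec_on F (y_vec R n)) (vec_on F (x_vec R m)) = (m == n)%:R.
Proof.
move=> nF; rewrite /cinner.
under eq_bigr do rewrite !mxE.
rewrite (sum_extF _ (fun p => y_vec R n p * (x_vec R m p)^*)).
rewrite y_vec_alpha y_vec_omega x_vec_alpha x_vec_omega conjC1 !mulr1 addNr add0r.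
rewrite (eq_bigr (fun s : F => if val s == n then (m == n)%:R else 0)) => [|s _].
  by rewrite sum_pt_eq.
rewrite y_vec_pt x_vec_pt conjC_nat; case: eqP => [->|_]; last by rewrite mul0r.
by rewrite mul1r eq_sym.
Qed.

Lemma E_matE (F : {fset nat}) n i k :
  E_mat R F n i k = vec_on F (y_vec R n) i 0 * (vec_on F (x_vec R n) k 0)^*.
Proof. by rewrite !mxE. Qed.

Lemma E_mat_mulmx (F : {fset nat}) n (v : 'cV[R[i]]_#|extF F|) :
  E_mat R F n *m v = cinner v (vec_on F (x_vec R n)) *: vec_on F (y_vec R n).
Proof.
apply/colP => i; rewrite !mxE /cinner mulr_suml; apply: eq_bigr => k _.
by rewrite !mxE /E_coef; ring.
Qed.

(** A rank-one operator is bounded by the product of the lengths of its two vectors, here sqrt 3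
    each. *)
Lemma E_mat_rnorm (F : {fset nat}) n : n \in F -> rnorm (E_mat R F n) <= 3.
Proof.
move=> nF; apply: cmat_le => // v; rewrite E_mat_mulmx l2nZ l2n_y_vec//.
rewrite (le_trans (ler_wpM2r _ (cinner_le _ _))) ?sqrtr_ge0// l2n_x_vec//.
by rewrite -mulrA -expr2 sqr_sqrtr// mulrC.
Qed.

Lemma E_mat_mul (F : {fset nat}) m n : n \in F ->
  E_mat R F m ** E_mat R F n = if m == n then E_mat R F n else 0.
Proof.
move=> nF; apply/matrixP => i k.
transitivity (vec_on F (y_vec R m) i 0 * (m == n)%:R * (vec_on F (x_vec R n) k 0)^*).
  rewrite -(cinner_y_x _ nF) mxE /cinner mulr_sumr mulr_suml; apply: eq_bigr => l _.
  by rewrite !E_matE; ring.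
case: eqP => [->|_]; first by rewrite mulr1 E_matE.
by rewrite mulr0 mul0r mxE.
Qed.

Lemma E_mat_omega_alpha (F : {fset nat}) n :
  E_mat R F n (enum_rank (Some None : extF F)) (enum_rank (None : extF F)) = 1.
Proof.
rewrite mxE !enum_rankK /E_coef /= -/(ext_omega nat) -/(ext_alpha nat).
by rewrite y_vec_omega x_vec_alpha conjC1 mulr1.
Qed.

End Idempotents.

(** * The homomorphism phi and its two bounds *)

Section Coordinates.
Variables (R : realType) (F : nefset).

Local Notation n := #|extF (val F)|.

Lemma prod_coord_linear (i k : 'I_n) :
  linear (fun x : prodM R => linf_fun x F i k : R[i]^o).
Proof. by move=> c x y; rewrite /= !mxE. Qed.

Lemma prod_coord_bounded (i k : 'I_n) (x : prodM R) :
  rnorm (linf_fun x F i k : R[i]^o) <= 1 * rnorm x.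
Proof.
rewrite mul1r; apply: le_trans (linf_coord_le x F).
exact: cmat_entry_le.
Qed.

Definition prod_coord (i k : 'I_n) : dual (prodM R) :=
  Blin (blin_of_subproof (prod_coord_linear i k) (prod_coord_bounded i k)).

End Coordinates.

Section Phi.
Variable R : realType.

Lemma phi_delta_subproof (j : nat) : @linf_pred R nefset (fun F => matF R (val F))
  (fun F : nefset => if j \in val F then E_mat R (val F) j else 0).
Proof.
apply: (@linf_predP _ _ _ _ 3) => F; case: ifP => [jF|_]; first exact: E_mat_rnorm.
by rewrite rnorm0.
Qed.

Definition phi_delta (j : nat) : prodM R := Linf (phi_delta_subproof j).

Lemma phi_delta_rnorm j : rnorm (phi_delta j) <= 3.
Proof.
apply: linf_rnorm_le => // F /=; case: ifP => [jF|_]; first exact: E_mat_rnorm.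
by rewrite rnorm0.
Qed.

Definition phi : blin (l1 R) (prodM R) := l1_lift phi_delta_rnorm.

Lemma phiP : is_phi phi.
Proof. by move=> j F; rewrite /phi l1_lift_delta. Qed.

Lemma phi_unique (psi : blin (l1 R) (prodM R)) : is_phi psi -> phi = psi.
Proof.
move=> psiP; apply: l1_ext => j; apply: linf_eqP => F.
by rewrite psiP phiP.
Qed.

Lemma phi_delta_mul i j : phi_delta i ** phi_delta j = if i == j then phi_delta j else 0.
Proof.
apply: linf_eqP => F.
transitivity ((if i \in val F then E_mat R (val F) i else 0) **
  (if j \in val F then E_mat R (val F) j else 0)); first by [].
have [jF|jF] := boolP (j \in val F); last first.
  rewrite bmulr0; case: eqP => _ //=.
  by rewrite (negPf jF).
case: ifPn => [iF|iF].
  by rewrite E_mat_mul//; case: eqP => //= _; rewrite jF.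
rewrite bmul0r; case: eqP => // ij; by rewrite ij jF in iF.
Qed.

(** Both sides are bounded bilinear maps, so orthogonality and idempotence of the images of the
    delta_j suffice. *)
Lemma phiM a b : phi (a ** b) = phi a ** phi b.
Proof.
pose f1 := blin_comp (postcomp _ phi) (bilin_mul (l1 R)).
pose f2 := blin_comp (precomp (prodM R) phi) (blin_comp (bilin_mul (prodM R)) phi).
have E : f1 = f2.
  apply: bilin_l1_ext => i j.
  transitivity (phi (l1_delta R i ** l1_delta R j)); first by [].
  transitivity (phi (l1_delta R i) ** phi (l1_delta R j)); last by [].
  rewrite l1_delta_mul blinZ /phi !l1_lift_delta phi_delta_mul l1_deltaE.
  by rewrite eq_sym; case: eqP => [->|_]; rewrite ?scale1r ?scale0r.
exact: (congr1 (fun f : blin (l1 R) (blin (l1 R) (prodM R)) => f a b) E).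
Qed.

Lemma coord_sum_seq_linear (s : seq nat) :
  linear (fun a : l1 R => \sum_(j <- s) a j : R[i]^o).
Proof. by move=> c a b; rewrite scaler_sumr -big_split. Qed.

Lemma coord_sum_seq_bounded (s : seq nat) (a : l1 R) :
  rnorm (\sum_(j <- s) a j : R[i]^o) <= (size s)%:R * rnorm a.
Proof.
rewrite (le_trans (rnorm_sum _ _ _))//.
rewrite (le_trans (ler_sum _ (fun j _ => l1_coord_le a j)))//.
by rewrite big_const_seq count_predT iter_addr_0 mulr_natl.
Qed.

Lemma phi_omega_alpha (F : nefset) a :
  linf_fun (phi a) F (enum_rank (Some None : extF (val F))) (enum_rank (None : extF (val F)))
  = \sum_(j <- enum_fset (val F)) a j.
Proof.
pose f1 : dual (l1 R) := blin_comp (prod_coord R (enum_rank (Some None : extF (val F)))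
  (enum_rank (None : extF (val F)))) phi.
pose f2 : dual (l1 R) := Blin (blin_of_subproof (coord_sum_seq_linear (enum_fset (val F)))
  (@coord_sum_seq_bounded (enum_fset (val F)))).
suff E : f1 = f2 by exact: (congr1 (fun f : dual (l1 R) => f a) E).
apply: l1_ext => j.
transitivity (linf_fun (phi (l1_delta R j)) F (enum_rank (Some None : extF (val F)))
  (enum_rank (None : extF (val F)))); first by [].
transitivity (\sum_(i <- enum_fset (val F)) l1_delta R j i); last by [].
rewrite phiP; have [jF|jF] := boolP (j \in val F).
  rewrite E_mat_omega_alpha (bigD1_seq j)//= ?fset_uniq// eqxx big1 ?addr0// => i ij.
  by rewrite (negPf ij).
rewrite mxE big_seq big1// => i iF; rewrite l1_deltaE.
by case: eqP => // ij; move: jF; rewrite -ij => /negP; case.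
Qed.

Lemma phi_subset_sum (a : l1 R) (n : nat) (P : pred 'I_n) :
  rnorm (\sum_(i | P i) a i) <= rnorm (phi a).
Proof.
pose s := [seq val i | i <- enum P]; pose F := [fset x in s]%fset.
have sF : \sum_(i | P i) a i = \sum_(j <- enum_fset F) a j.
  rewrite (perm_big s); last first.
    apply: uniq_perm; rewrite ?fset_uniq ?(map_inj_uniq val_inj) ?enum_uniq// => x.
    by rewrite in_fset.
  by rewrite big_map big_enum.
(* The empty set does not index a factor of the product; its sum is 0. *)
have [F0|F0] := eqVneq F fset0.
  by rewrite sF F0 big_nil [X in X <= _]rnorm0 rnorm_ge0.
rewrite sF -(@phi_omega_alpha (exist _ F F0)).
apply: le_trans (linf_coord_le (phi a) (exist _ F F0)).
exact: cmat_entry_le.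
Qed.

Lemma phi_lower a : pi^-1 * rnorm a <= rnorm (phi a).
Proof.
rewrite ler_pdivrMl ?pi_gt0//; apply: l1_rnorm_le => n.
rewrite /series/= big_mkord; apply: subset_sum_bound => P.
exact: phi_subset_sum.
Qed.

Lemma phi_upper a : rnorm (phi a) <= 3 * rnorm a.
Proof.
apply: (le_trans (blin_rnorm_ge _ _)); rewrite ler_wpM2r ?rnorm_ge0//.
exact: l1_lift_rnorm.
Qed.

End Phi.

(** * The separable predual of M *)

Lemma scale_add_diff (K : pzRingType) (V : lmodType K) (c q : K) (g s h t : V) :
  c *: g + h - (q *: s + t) = c *: (g - s) + (c - q) *: s + (h - t).
Proof. by rewrite scalerBr scalerBl [X in _ = X + _]addrA subrK opprD addrACA. Qed.

Section NullAlgebra.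
Variables (R : realType) (V : completeNormedModType R[i]).

(* V with the product 0, so that its closed subspaces are closed subalgebras. *)
Definition null_alg : Type := V.

HB.instance Definition _ := CompleteNormedModule.copy null_alg V.

Definition null_mul (x y : null_alg) : null_alg := 0.

Lemma null_mulA : associative null_mul. Proof. by []. Qed.
Lemma null_mulDl : left_distributive null_mul +%R.
Proof. by move=> x y z; rewrite /null_mul addr0. Qed.
Lemma null_mulDr : right_distributive null_mul +%R.
Proof. by move=> x y z; rewrite /null_mul addr0. Qed.
Lemma null_mulZl (c : R[i]) x y : null_mul (c *: x) y = c *: null_mul x y.
Proof. by rewrite /null_mul scaler0. Qed.
Lemma null_mulZr (c : R[i]) x y : null_mul x (c *: y) = c *: null_mul x y.
Proof. by rewrite /null_mul scaler0. Qed.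
Lemma null_normM x y : `|null_mul x y| <= `|x| * `|y|.
Proof. by rewrite normr0 mulr_ge0. Qed.

HB.instance Definition _ := isBanachAlgebra.Build R null_alg
  null_mulA null_mulDl null_mulDr null_mulZl null_mulZr null_normM.

End NullAlgebra.

(** At w = A v the form is the square of the length of A v, and one factor cancels. *)
Lemma cmat_rnorm_le_cinner (R : realType) n (A : cmat R n) (K : R) : 0 <= K ->
  (forall v w, rnorm (cinner (A *m v) w) <= K * l2n v * l2n w) -> cmat_rnorm A <= K.
Proof.
move=> K0 h; apply: cmat_le => // v.
have [a0|a0] := eqVneq (l2n (A *m v)) 0; first by rewrite a0 mulr_ge0// l2n_ge0.
have ap : 0 < l2n (A *m v) by rewrite lt_def a0 l2n_ge0.
have := h v (A *m v).
by rewrite cinner_sqr -rmorphXn rnorm_real ger0_norm ?exprn_ge0 ?l2n_ge0// expr2 ler_pM2r.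
Qed.

Section Predual.
Variable R : realType.

Local Notation M := (prodM R).
Local Notation N := (null_alg (cdual M)).

Definition normal_set : set N := [set f | forall C : closedSubalg N,
  (forall F i k, csa_set C (@prod_coord R F i k : N)) -> csa_set C f].

Lemma normal_set0 : normal_set 0.
Proof. by move=> C _; exact: csa0. Qed.

Lemma normal_setP (c : R[i]) x y : normal_set x -> normal_set y -> normal_set (c *: x + y).
Proof. by move=> hx hy C hC; apply: csaP; [exact: hx|exact: hy]. Qed.

Lemma normal_setM x y : normal_set x -> normal_set y -> normal_set (x ** y).
Proof. by move=> _ _; exact: normal_set0. Qed.

Lemma normal_set_closed : closed normal_set.
Proof.
apply: closed_rnorm => x h C hC; apply: csa_closed; apply/closure_rnormP => e e0.
by have [y hy xy] := h e e0; exists y => //; exact: hy.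
Qed.

(* The predual of M: the closed span of the matrix coefficients in M'. *)
Definition normal_subspace : closedSubalg N :=
  ClosedSubalg normal_set0 normal_setP normal_setM normal_set_closed.

Local Notation E := (csa_type normal_subspace).

Lemma normal_coord_subproof (F : nefset) (i k : 'I_#|extF (val F)|) :
  (prod_coord R i k : N) \in csa_pred normal_subspace.
Proof. by apply/asboolP => C hC; exact: hC. Qed.

Definition normal_coord (F : nefset) (i k : 'I_#|extF (val F)|) : E :=
  CsaType (normal_coord_subproof i k).

(** The image of [P] in M' is a closed subspace containing the matrix coefficients, so minimality of
    the span applies to it. *)
Lemma normal_ind (P : set E) : P 0 ->
  (forall (c : R[i]) f g, P f -> P g -> P (c *: f + g)) -> closed P ->
  (forall F i k, P (@normal_coord F i k)) -> forall f, P f.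
Proof.
move=> P0 Plin Pc Pcoord f.
pose C : set N := [set g | exists2 h : E, csa_val h = g & P h].
have C0 : C 0 by exists 0.
have Clin (c : R[i]) x y : C x -> C y -> C (c *: x + y).
  by move=> [h <- Ph] [k <- Pk]; exists (c *: h + k) => //; exact: Plin.
have CM x y : C x -> C y -> C (x ** y) by [].
have Cc : closed C.
  apply: closed_rnorm => x hx.
  (* The limit is first placed in the span, where it becomes a point of [E] and closedness of [P]
     can be used. *)
  have xE : x \in csa_pred normal_subspace.
    apply/asboolP; apply: csa_closed; apply/closure_rnormP => e /hx[_ [h <- _] xh].
    by exists (csa_val h) => //; exact: csa_valP.
  exists (CsaType xE) => //; apply: Pc; apply/closure_rnormP => e /hx[_ [h <- Ph] xh].
  by exists h.
have [h hf Ph] : C (csa_val f).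
  apply: (csa_valP f (ClosedSubalg C0 Clin CM Cc)) => F i k.
  by exists (normal_coord i k).
by rewrite (_ : f = h)//; exact: val_inj.
Qed.

Lemma csa_val_linear (c : R[i]) (f g : E) : csa_val (c *: f + g) = c *: csa_val f + csa_val g.
Proof. reflexivity. Qed.

Lemma normal_eval_linear (x : M) : linear (fun f : E => (csa_val f : dual M) x : R[i]^o).
Proof. by move=> c f g; rewrite csa_val_linear. Qed.

Lemma normal_eval_bounded (x : M) (f : E) :
  rnorm ((csa_val f : dual M) x : R[i]^o) <= rnorm x * rnorm f.
Proof. by rewrite mulrC; exact: (blin_rnorm_ge (csa_val f : dual M) x). Qed.

Definition normal_eval (x : M) : dual E :=
  Blin (blin_of_subproof (normal_eval_linear x) (normal_eval_bounded x)).

Lemma normal_eval_subproof : normal_eval \in @blin_pred R M (dual E).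
Proof.
apply: (@blin_of_subproof _ _ _ _ 1) => [c x y|x].
  by apply/val_inj/funext => f; exact: (linearP (csa_val f : dual M)).
by rewrite mul1r; apply: blin_opn_le => [|f]; [exact: rnorm_ge0|exact: normal_eval_bounded].
Qed.

Definition normal_duality : blin M (dual E) := Blin normal_eval_subproof.

(* The functional x |-> <x_F v, w>. *)
Definition normal_form (F : nefset) (v w : 'cV[R[i]]_#|extF (val F)|) : E :=
  \sum_i \sum_k (v k 0 * (w i 0)^*) *: normal_coord i k.

(** Stated for an arbitrary [g]: evaluations at points of M yield the isometry, general functionals
    the surjectivity. *)
Lemma normal_formE (g : dual E) (F : nefset) (v w : 'cV[R[i]]_#|extF (val F)|) :
  g (normal_form v w) = cinner ((\matrix_(i, k) g (normal_coord i k)) *m v) w.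
Proof.
rewrite /normal_form linear_sum /cinner; apply: eq_bigr => i _.
rewrite linear_sum mxE mulr_suml; apply: eq_bigr => k _.
rewrite mxE; apply: etrans (blinZ _ _ _) _.
by rewrite [LHS]mulrC mulrA.
Qed.

Lemma normal_form_duality (x : M) (F : nefset) (v w : 'cV[R[i]]_#|extF (val F)|) :
  normal_duality x (normal_form v w) = cinner (linf_fun x F *m v) w.
Proof.
rewrite normal_formE; congr (cinner (_ *m v) w).
by apply/matrixP => i k; rewrite mxE.
Qed.

Lemma normal_form_rnorm (F : nefset) (v w : 'cV[R[i]]_#|extF (val F)|) :
  rnorm (normal_form v w) <= l2n v * l2n w.
Proof.
apply: (@blin_opn_le R M R[i]^o) => [|x]; first by rewrite mulr_ge0// l2n_ge0.
have -> : (csa_val (normal_form v w) : dual M) x = normal_duality x (normal_form v w) by [].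
rewrite normal_form_duality (le_trans (cinner_le _ _))// [leRHS]mulrC mulrA.
rewrite ler_wpM2r ?l2n_ge0// (le_trans (cmat_ge _ _))//.
by rewrite ler_wpM2r ?l2n_ge0//; exact: (linf_coord_le x F).
Qed.

Lemma normal_form_le (g : dual E) (F : nefset) (v w : 'cV[R[i]]_#|extF (val F)|) :
  rnorm (g (normal_form v w) : R[i]) <= rnorm g * l2n v * l2n w.
Proof.
apply: (le_trans (blin_rnorm_ge g _)); rewrite -mulrA ler_wpM2l ?rnorm_ge0//.
exact: normal_form_rnorm.
Qed.

(** The norm of each block is detected by the functionals <x_F v, w>, which lie in [E] with norm at
    most the product of the lengths of v and w. *)
Lemma normal_duality_isometry (x : M) : `|normal_duality x| = `|x|.
Proof.
rewrite !rnormE; congr (_%:C); apply/eqP; rewrite eq_le; apply/andP; split.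
  apply: blin_opn_le => [|f]; [exact: rnorm_ge0|exact: normal_eval_bounded].
apply: linf_rnorm_le => [|F]; first exact: rnorm_ge0.
apply: cmat_rnorm_le_cinner => [|v w]; first exact: rnorm_ge0.
by rewrite -normal_form_duality; exact: normal_form_le.
Qed.

Lemma normal_ext (g h : dual E) :
  (forall F i k, g (@normal_coord F i k) = h (normal_coord i k)) -> g = h.
Proof.
move=> gh; apply/val_inj/funext.
apply: (@normal_ind (fun f => g f = h f)) => [|c f f' fE f'E||//].
- exact: etrans (linear0 g) (esym (linear0 h)).
- apply: etrans (linearP g c f f') _; apply: etrans (esym (linearP h c f f')).
  by congr (_ *: _ + _).
- apply: closed_rnorm => f hf.
  have [K K0 hK] := blin_pos_bound (g - h).
  apply: (@rnorm_le_eq R R[i]^o) => e e0.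
  have [f' f'E ff'] := hf _ (divr_gt0 e0 K0).
  have -> : g f - h f = (g - h : dual E) (f - f').
    rewrite blinB -[LHS]subr0; congr (_ - _); apply/esym/eqP; rewrite subr_eq0.
    by apply/eqP; exact: f'E.
  by apply: (le_trans (hK _)); rewrite -ler_pdivlMl// mulrC.
Qed.

(** The values of [g] at the matrix coefficients form the blocks of the preimage; the norm of [g]
    bounds all of them uniformly, so they define an element of M. *)
Lemma normal_duality_onto (g : dual E) : exists x : M, normal_duality x = g.
Proof.
pose A (F : nefset) : matF R (val F) := \matrix_(i, k) g (@normal_coord F i k).
have Ab (F : nefset) : rnorm (A F) <= rnorm g.
  apply: cmat_rnorm_le_cinner => [|v w]; first exact: rnorm_ge0.
  by rewrite -normal_formE; exact: normal_form_le.
exists (Linf (linf_predP Ab)); apply: normal_ext => F i k.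
by transitivity (A F i k) => //; rewrite mxE.
Qed.

Lemma prodM_predual : is_predual M E.
Proof. by exists normal_duality; split; [exact: normal_duality_isometry|exact: normal_duality_onto]. Qed.

Definition rat_complex (q : rat * rat) : R[i] := ratr q.1 +i* ratr q.2.

Lemma rat_complex_near (c : R[i]) (e : R) : 0 < e ->
  exists q, rnorm (c - rat_complex q) <= e.
Proof.
move=> e0; have near (x : R) : exists q : rat, `|x - ratr q| <= e / 2.
  have [|q] := @rat_in_itvoo R (x - e / 2) (x + e / 2); first by lra.
  rewrite in_itv/= => /andP[q1 q2]; exists q.
  by rewrite ler_norml; apply/andP; split; lra.
case: c => a b; have [p pa] := near a; have [q qb] := near b.
exists (p, q); apply: (le_trans (rnorm_ReIm _)).
by rewrite (splitr e) lerD.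
Qed.

Definition coef_index : Type :=
  {F : nefset & ('I_#|extF (val F)| * 'I_#|extF (val F)|)%type}.

Definition rat_comb (s : seq ((rat * rat) * coef_index)) : E :=
  \sum_(t <- s) rat_complex t.1 *: normal_coord (tagged t.2).1 (tagged t.2).2.

Lemma rat_comb_lin q s t : exists u, rat_complex q *: rat_comb s + rat_comb t = rat_comb u.
Proof.
pose mulq (p : rat * rat) : rat * rat := (q.1 * p.1 - q.2 * p.2, q.1 * p.2 + q.2 * p.1).
exists ([seq (mulq x.1, x.2) | x <- s] ++ t).
rewrite /rat_comb big_cat big_map; congr (_ + _); apply: etrans (scaler_sumr _ _ _ _) _.
apply: eq_bigr => x _; apply: etrans (scalerA _ _ _) _; congr (_ *: _); rewrite /rat_complex /mulq /=.
by rewrite !rmorphB !rmorphD !rmorphM.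
Qed.

Lemma rat_comb_dense (f : E) : closure (range rat_comb) f.
Proof.
apply: normal_ind; last 2 first.
- exact: closed_closure.
- move=> F i k; apply: subset_closure.
  exists [:: ((1, 0), Tagged (fun F : nefset => ('I_#|extF (val F)| * 'I_#|extF (val F)|)%type) (i, k))] => //.
  rewrite /rat_comb big_seq1 /= /rat_complex rmorph1 rmorph0.
  by rewrite (_ : 1 +i* 0 = 1)// scale1r.
- by apply: subset_closure; exists [::] => //; rewrite /rat_comb big_nil.
move=> c g h /closure_rnormP gc /closure_rnormP hc; apply/closure_rnormP => e e0.
have e3 : 0 < e / 3 by rewrite divr_gt0.
have c1 : 0 < rnorm c + 1 by rewrite ltr_wpDl ?rnorm_ge0.
have [_ [s _ <-] gs] := gc _ (divr_gt0 e3 c1).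
have s1 : 0 < rnorm (rat_comb s) + 1 by rewrite ltr_wpDl ?rnorm_ge0.
(* The scalar is approximated after [s] is fixed, since its error is multiplied by the norm of
   [rat_comb s]. *)
have [q cq] := rat_complex_near c (divr_gt0 e3 s1).
have [_ [t _ <-] ht] := hc _ e3.
have [u uE] := rat_comb_lin q s t.
exists (rat_comb u) => //; rewrite -uE.
have -> : c *: g + h - (rat_complex q *: rat_comb s + rat_comb t) =
    c *: (g - rat_comb s) + (c - rat_complex q) *: rat_comb s + (h - rat_comb t).
  exact: scale_add_diff.
rewrite [leRHS](_ : e = e / 3 + e / 3 + e / 3); last by field.
rewrite (le_trans (rnormD _ _))// lerD// (le_trans (rnormD _ _))// !rnormZ lerD//.
  rewrite (@le_trans _ _ ((rnorm c + 1) * rnorm (g - rat_comb s)))//.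
    by rewrite ler_wpM2r ?rnorm_ge0// lerDl.
  by rewrite -ler_pdivlMl// mulrC.
rewrite (@le_trans _ _ (rnorm (c - rat_complex q) * (rnorm (rat_comb s) + 1)))//.
  by rewrite ler_wpM2l ?rnorm_ge0// lerDl.
by rewrite -ler_pdivlMr.
Qed.

Lemma prodM_separable_predual : separable_predual M.
Proof.
exists E; first exact: prodM_predual.
exists (range rat_comb).
  by apply: card_le_trans (card_image_le _ _) _; exact: countableP.
move=> O [f Of] oO.
have [g [gD gO]] := rat_comb_dense (open_nbhs_nbhs (conj oO Of)).
by exists g.
Qed.

Lemma prodM_von_neumann : von_neumann_algebra M.
Proof. by exists E; exact: prodM_predual. Qed.

End Predual.

(** * Finiteness and type I *)

Section FiniteTypeI.
Variable R : realType.

Local Notation M := (prodM R).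

Lemma cmat_rnorm1_le n : cmat_rnorm (1%:M : cmat R n) <= 1.
Proof. by apply: cmat_le => // v; rewrite mul1mx mul1r. Qed.

Definition prod_unit : M :=
  Linf (@linf_predP R nefset (fun F => matF R (val F)) (fun F => 1%:M) 1
    (fun F => cmat_rnorm1_le _)).

(** Every block is a matrix algebra, where a one-sided inverse is two-sided. *)
Lemma prodM_finite : finite_algebra M.
Proof.
exists prod_unit => [x|u uu].
  by split; apply: linf_eqP => F; [exact: mul1mx|exact: mulmx1].
apply: linf_eqP => F; apply: mulmx1C.
exact: (congr1 (fun x : M => linf_fun x F) uu).
Qed.

(** The type of a block depends on its index, so [A] has to be transported along the equality of the
    indices. *)
Definition single_fun (F : nefset) (A : matF R (val F)) (G : nefset) : matF R (val G) :=
  if pselect (F = G) is left FG then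
    eq_rect F (fun G : nefset => matF R (val G)) A G FG
  else 0.

Lemma single_funE (F : nefset) (A : matF R (val F)) : single_fun A F = A.
Proof.
rewrite /single_fun; case: pselect => [FF|//].
by rewrite (Prop_irrelevance FF erefl).
Qed.

Lemma single_fun_neq (F G : nefset) (A : matF R (val F)) : F <> G -> single_fun A G = 0.
Proof. by rewrite /single_fun; case: pselect. Qed.

Lemma single_bounded (F : nefset) (A : matF R (val F)) G : rnorm (single_fun A G) <= rnorm A.
Proof.
have [<-|FG] := pselect (F = G); first by rewrite single_funE.
by rewrite single_fun_neq// rnorm0 rnorm_ge0.
Qed.

Definition single (F : nefset) (A : matF R (val F)) : M := Linf (linf_predP (single_bounded A)).

Lemma prod_eq_single (F : nefset) (A : matF R (val F)) (x : M) :
  linf_fun x F = A -> (forall G, F <> G -> linf_fun x G = 0) -> x = single A.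
Proof.
move=> xF xG; apply: linf_eqP => G /=.
have [FG|FG] := pselect (F = G); first by case: G / FG; rewrite single_funE.
by rewrite single_fun_neq// xG.
Qed.

Lemma single_mul (F : nefset) (A : matF R (val F)) (x : M) :
  single A ** x = single (A ** linf_fun x F).
Proof.
apply: prod_eq_single => [|G FG]; first by rewrite /= single_funE.
by rewrite /= single_fun_neq// bmul0r.
Qed.

Lemma mul_single (F : nefset) (A : matF R (val F)) (x : M) :
  x ** single A = single (linf_fun x F ** A).
Proof.
apply: prod_eq_single => [|G FG]; first by rewrite /= single_funE.
by rewrite /= single_fun_neq// bmulr0.
Qed.

Lemma star0 (A : cstarAlgType R) : star (0 : A) = 0.
Proof. by apply: (addrI (star 0)); rewrite -starD !addr0. Qed.

Lemma star_single (F : nefset) (A : matF R (val F)) : star (single A) = single (star A).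
Proof.
apply: prod_eq_single => [|G FG]; first by rewrite /= single_funE.
by rewrite /= single_fun_neq// star0.
Qed.

Lemma scale_single (F : nefset) (A : matF R (val F)) c : c *: single A = single (c *: A).
Proof.
apply: prod_eq_single => [|G FG]; first by rewrite /= single_funE.
by rewrite /= single_fun_neq// scaler0.
Qed.

Lemma mul_delta_mx_l n (i : 'I_n) (A : 'M[R[i]]_n) p q :
  (delta_mx i i *m A) p q = if p == i then A i q else 0.
Proof.
rewrite mxE (bigD1 i)//= big1 ?addr0 => [|k ki]; last by rewrite mxE (negPf ki) andbF mul0r.
by rewrite mxE eqxx andbT; case: eqP => _; rewrite ?mul1r ?mul0r.
Qed.

Lemma delta_mx_compress n (i : 'I_n) (A : 'M[R[i]]_n) :
  delta_mx i i *m A *m delta_mx i i = A i i *: delta_mx i i.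
Proof.
apply/matrixP => p q; rewrite mxE (bigD1 i)//= big1 ?addr0 => [|k ki]; last first.
  by rewrite [X in _ * X]mxE (negPf ki) mulr0.
rewrite mul_delta_mx_l !mxE eqxx/=.
by case: eqP => _; rewrite ?mul0r ?mulr0.
Qed.

(** Comparing the entries at (p, j) of Z e_ij and e_ij Z: a central matrix is scalar. *)
Lemma central_mx_entry n (Z : 'M[R[i]]_n) (p i j : 'I_n) :
  (forall A : 'M[R[i]]_n, Z *m A = A *m Z) -> Z p i = if p == i then Z j j else 0.
Proof.
move=> Zc; have := congr1 (fun B : 'M[R[i]]_n => B p j) (Zc (delta_mx i j)).
rewrite !mxE (bigD1 i)//= big1 ?addr0 => [|k ki]; last first.
  by rewrite mxE (negPf ki) mulr0.
rewrite mxE !eqxx mulr1 => ->.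
rewrite (bigD1 j)//= big1 ?addr0 => [|k kj]; last first.
  by rewrite mxE (negPf kj) andbF mul0r.
by rewrite mxE eqxx andbT; case: eqP => _; rewrite ?mul1r ?mul0r.
Qed.

(** In a block where the central projection is non-zero it is a scalar idempotent, hence the
    identity, so a diagonal matrix unit of that block lies below it. *)
Lemma prodM_type_I : type_I M.
Proof.
move=> z [_ zz] zc z0.
have [F zF] : exists F, linf_fun z F <> 0.
  by apply/not_existsP => h; apply: z0; apply: linf_eqP => F; apply: contrapT => /h.
set Z := linf_fun z F : 'M_ _.
have Zc (A : 'M_ _) : Z *m A = A *m Z.
  have := zc (single (A : matF R (val F))); rewrite single_mul mul_single.
  by move=> /(congr1 (fun x : M => linf_fun x F)) /=; rewrite !single_funE.
have [i [k Zik]] : exists i k, Z i k != 0.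
  apply: contrapT => h; apply: zF; apply/matrixP => i k; rewrite mxE.
  by apply: contrapT => /eqP ik; apply: h; exists i, k.
have Zii : Z i i != 0.
  move: Zik; rewrite (@central_mx_entry _ Z i k i Zc).
  by case: (i =P k); rewrite ?eqxx.
have ZZ : Z i i * Z i i = Z i i.
  have := congr1 (fun x : M => linf_fun x F i i) zz.
  rewrite /= -/Z mxE (bigD1 i)//= big1 ?addr0// => l li.
  by rewrite (@central_mx_entry _ Z i l i Zc) eq_sym (negPf li) mul0r.
have Z1 : Z i i = 1 by apply: (mulfI Zii); rewrite ZZ mulr1.
pose D : matF R (val F) := delta_mx i i.
(* Compression by a diagonal matrix unit leaves only scalar multiples of it, and these commute. *)
have DE (x : M) : single D ** x ** single D = (linf_fun x F i i) *: single D.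
  rewrite single_mul mul_single scale_single; congr single.
  by rewrite /= single_funE; exact: delta_mx_compress.
exists (single D); split; last first.
- rewrite single_mul; congr single; apply/matrixP => p q.
  rewrite [LHS]mul_delta_mx_l -/Z (@central_mx_entry _ Z i q i Zc) Z1 mxE.
  by rewrite [q == i]eq_sym; case: (p == i); case: (i == q).
- move=> /(congr1 (fun x : M => linf_fun x F i i)); rewrite /= single_funE !mxE !eqxx.
  by move/eqP; rewrite oner_eq0.
- split; last by move=> x y; rewrite !DE !(bmulZl, bmulZr) !scalerA mulrC.
  split.
    rewrite star_single; congr single; apply/matrixP => p q.
    rewrite !mxE andbC; exact: conjC_nat.
  rewrite single_mul; congr single; rewrite /= single_funE.
  by apply/matrixP => p q; rewrite [LHS]mul_delta_mx_l !mxE eqxx; case: eqP.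
Qed.

End FiniteTypeI.

(** * Maps bounded below and the conclusion *)

Section BoundedBelow.
Variables (R : realType) (A : banachAlgType R) (f : blin (l1 R) A) (c : R).
Hypothesis fM : forall a b, f (a ** b) = f a ** f b.
Hypothesis c0 : 0 < c.
Hypothesis f_below : forall a, rnorm a <= c * rnorm (f a).

Lemma below_inj : injective f.
Proof.
move=> a b ab; apply/eqP; rewrite -subr_eq0; apply/eqP/rnorm0_eq0.
apply/eqP; rewrite eq_le rnorm_ge0 andbT (le_trans (f_below _))//.
by rewrite blinB ab subrr rnorm0 mulr0.
Qed.

(** The approximate preimages of [y] generate a filter, Cauchy because [f] is bounded below; its
    limit is a preimage of [y]. *)
Lemma closed_range_below : closed (range f).
Proof.
move=> y /closure_rnormP hy.
pose B (e : R) : set (l1 R) := [set a | rnorm (y - f a) <= e].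
pose F : set_system (l1 R) := filter_from [set e : R | 0 < e] B.
have FF : ProperFilter F.
  apply: filter_from_proper => [|e e0]; last first.
    by have [_ [a _ <-] ya] := hy e e0; exists a.
  apply: filter_from_filter; first by exists 1; exact: ltr01.
  move=> e d /= e0 d0; exists (Num.min e d); first by rewrite /= lt_min e0.
  by move=> a; rewrite /B /= le_min => /andP.
have Fc : cauchy F.
  apply/cauchyP => e e0.
  have eR : e = (complex.Re e)%:C by rewrite RRe_real// gtr0_real.
  have Re0 : 0 < complex.Re e by move: e0; rewrite ltcE => /andP[].
  (* Two approximate preimages have images within 2 d, so they differ by at most 2 c d, which is
     half of the tolerance. *)
  pose d := complex.Re e / (4 * c).
  have d0 : 0 < d by rewrite divr_gt0// mulr_gt0.
  have [_ [a _ <-] ya] := hy d d0; exists a; exists d => // b yb.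
  rewrite eR; apply/rnorm_lt_ball; rewrite (le_lt_trans (f_below _))//.
  rewrite blinB (@le_lt_trans _ _ (c * (d + d)))//.
    rewrite ler_wpM2l ?(ltW c0)// (le_trans (ler_rnormB _ y _))// lerD//.
    by rewrite rnormB.
  rewrite (_ : c * (d + d) = complex.Re e / 2); last first.
    by rewrite /d; field; rewrite gt_eqF.
  by rewrite ltr_pdivrMr// ltr_pMr// ltr1n.
have /cvg_ex[a Fa] : cvg F by exact: cauchy_cvg.
exists a => //; symmetry; apply: rnorm_le_eq => e e0.
have [K K0 hK] := blin_pos_bound f.
have e2 : 0 < (e / 2 / K)%:C by rewrite ltcR !divr_gt0.
have Fy : F (B (e / 2)) by exists (e / 2) => //=; rewrite divr_gt0.
have [b [/rnorm_lt_ball ab yb]] := filter_ex (filterI (Fa _ (nbhsx_ballx a _ e2)) Fy).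
rewrite (le_trans (ler_rnormB _ (f b) _))// (splitr e) lerD//.
rewrite rnormB -blinB (le_trans (hK _))// -ler_pdivlMl// mulrC.
exact: ltW.
Qed.

Lemma range_below0 : range f 0.
Proof. by exists 0 => //; rewrite linear0. Qed.

Lemma range_belowP (z : R[i]) x y : range f x -> range f y -> range f (z *: x + y).
Proof. by move=> [a _ <-] [b _ <-]; exists (z *: a + b) => //; rewrite linearP. Qed.

Lemma range_belowM x y : range f x -> range f y -> range f (x ** y).
Proof. by move=> [a _ <-] [b _ <-]; exists (a ** b) => //; exact: fM. Qed.

Definition below_range : closedSubalg A :=
  ClosedSubalg range_below0 range_belowP range_belowM closed_range_below.

Local Notation S := (csa_type below_range).

Lemma below_to_subproof a : f a \in csa_pred below_range.
Proof. by apply/asboolP; exists a. Qed.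

Definition below_to_fun (a : l1 R) : S := CsaType (below_to_subproof a).

Lemma below_to_linear : linear below_to_fun.
Proof. by move=> z a b; apply: val_inj; exact: (linearP f). Qed.

Lemma below_to_bounded a : rnorm (below_to_fun a) <= rnorm f * rnorm a.
Proof. exact: blin_rnorm_ge. Qed.

Definition below_to : blin (l1 R) S := Blin (blin_of_subproof below_to_linear below_to_bounded).

Lemma below_from_exists (x : S) : exists a, f a = csa_val x.
Proof. by have [a _ ax] := csa_valP x; exists a. Qed.

Definition below_from_fun (x : S) : l1 R := sval (cid (below_from_exists x)).

Lemma below_from_funK (x : S) : f (below_from_fun x) = csa_val x.
Proof. exact: (svalP (cid (below_from_exists x))). Qed.

Lemma below_from_linear : linear below_from_fun.
Proof.
move=> z x y; apply: below_inj; rewrite below_from_funK; apply: etrans (esym (linearP f _ _ _)).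
by congr (_ *: _ + _); exact: esym (below_from_funK _).
Qed.

Lemma below_from_bounded x : rnorm (below_from_fun x) <= c * rnorm x.
Proof. by apply: le_trans (f_below _) _; rewrite below_from_funK. Qed.

Definition below_from : blin S (l1 R) :=
  Blin (blin_of_subproof below_from_linear below_from_bounded).

Lemma below_toK : cancel below_to below_from.
Proof. by move=> a; apply: below_inj; exact: below_from_funK. Qed.

Lemma below_fromK : cancel below_from below_to.
Proof. by move=> x; apply: val_inj; exact: below_from_funK. Qed.

Lemma below_toM a b : below_to (a ** b) = below_to a ** below_to b.
Proof. by apply: val_inj; exact: fM. Qed.

Definition below_iso : l1_iso S := L1Iso below_toK below_fromK below_toM.

End BoundedBelow.

Lemma phi_lower_bound (R : realType) (a : l1 R) : rnorm a <= pi * rnorm (phi R a).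
Proof. by rewrite -ler_pdivrMl ?pi_gt0//; exact: phi_lower. Qed.

Theorem mainTheorem2 (R : realType) :
  [/\ von_neumann_algebra (prodM R), finite_algebra (prodM R),
      type_I (prodM R) & separable_predual (prodM R)] /\
  exists phi : blin (l1 R) (prodM R),
    [/\ unique (@is_phi R) phi,
        forall a b : l1 R, phi (a ** b) = phi a ** phi b,
        forall a : l1 R,
          pi^-1 * rnorm a <= rnorm (phi a) /\ rnorm (phi a) <= 3 * rnorm a,
        closed (range phi) &
        exists S : closedSubalg (prodM R), csa_set S = range phi /\
          [/\ forall x y : csa_type S, x ** y = y ** x,
              semisimple (csa_type S),
              singly_generated (csa_type S),
              biflat (csa_type S) &
              ~ amenable (csa_type S)]].
Proof.
split.
  split; [exact: prodM_von_neumann|exact: prodM_finite|exact: prodM_type_I|].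
  exact: prodM_separable_predual.
exists (phi R); split.
- by split; [exact: phiP|exact: phi_unique].
- exact: phiM.
- by move=> a; split; [exact: phi_lower|exact: phi_upper].
- exact: (closed_range_below (pi_gt0 R) (@phi_lower_bound R)).
- pose w := below_iso (@phiM R) (pi_gt0 R) (@phi_lower_bound R).
  exists (below_range (@phiM R) (pi_gt0 R) (@phi_lower_bound R)); split => //; split.
  + exact: (l1_iso_commutative w).
  + exact: (l1_iso_semisimple w).
  + exact: (l1_iso_singly_generated w).
  + exact: (l1_iso_biflat w).
  + exact: (l1_iso_not_amenable w).
Qed.
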